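(* Given a mixed graph $G$ on $n$ nodes and a set $P\subseteq V\times V$ of ordered node pairs, one can decide in $n^{O(|P|)}$ time whether $G$ is $P$-orientable. In particular, for constant $|P|$ this can be decided in polynomial time.
   Context: A mixed graph may contain both undirected edges and directed arcs (parallel edges allowed). An orientation of a mixed graph is the directed graph obtained by assigning to each undirected edge one of its two directions (arcs keep their direction). For a directed graph $D$ and a collection $P$ of ordered pairs, $P[D]$ is the set of pairs $(u,v)\in P$ such that $D$ contains a directed $uv$-path; $D$ satisfies $P$ if $P[D]=P$. A mixed graph $G$ is $P$-orientable if it has an orientation satisfying $P$.
   Formalization: Since parallel edges are allowed, the input may be too long to read in n^{O(|P|)} time; the bound proved is (n+m+2)^{O(|P|+1)}, where m is the total number of edges and arcs. *)

(* Defs.v *)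
From mathcomp Require Import all_boot.
Set Implicit Arguments. Unset Strict Implicit. Unset Printing Implicit Defensive.

(* A mixed graph on the node set 'I_n: a list of undirected edges and a
   list of directed arcs (lists, so parallel edges/arcs are allowed).
   An undirected edge (u,v) is an unordered pair; the order in the list
   entry is irrelevant for the notion of orientation below.            *)
Record mixed_graph (n : nat) := MixedGraph {
  medges : seq ('I_n * 'I_n);
  marcs  : seq ('I_n * 'I_n)
}.

Definition orient n (G : mixed_graph n)
    (o : {ffun 'I_(size (medges G)) -> bool}) : seq ('I_n * 'I_n) :=
  marcs G ++ [seq if eb.2 then eb.1 else (eb.1.2, eb.1.1)
             | eb <- zip (medges G) (codom o)].

(* D contains a directed uv-path (the length-0 path counts when u = v). *)
Definition has_path n (D : seq ('I_n * 'I_n)) (u v : 'I_n) : bool :=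
  connect (fun x y => (x, y) \in D) u v.

Definition sat_pairs n (D : seq ('I_n * 'I_n)) (P : {set 'I_n * 'I_n})
  : {set 'I_n * 'I_n} := [set p in P | has_path D p.1 p.2].

Definition satisfies n (D : seq ('I_n * 'I_n)) (P : {set 'I_n * 'I_n}) : bool :=
  sat_pairs D P == P.

Definition P_orientable n (G : mixed_graph n) (P : {set 'I_n * 'I_n}) : bool :=
  [exists o : {ffun 'I_(size (medges G)) -> bool}, satisfies (orient o) P].

(* Machine model: unit-cost RAM with addition, truncated subtraction,  *)
(* indirect addressing and conditional jumps (polynomially equivalent  *)
(* to Turing machines).                                                *)

Inductive instr :=
| IConst (r k : nat)
| IAdd   (r a b : nat)
| ISub   (r a b : nat)
| ILoad  (r a : nat)
| IStore (a r : nat)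
| IJz    (r l : nat)
| IJmp   (l : nat)
| IHalt.

Record ram_state := RamState { pc : nat; mem : nat -> nat }.

Definition upd (m : nat -> nat) (a v : nat) : nat -> nat :=
  fun x => if x == a then v else m x.

Definition step_instr (i : instr) (s : ram_state) : ram_state :=
  let m := mem s in let p := pc s in
  match i with
  | IConst r k => RamState p.+1 (upd m r k)
  | IAdd r a b => RamState p.+1 (upd m r (m a + m b))
  | ISub r a b => RamState p.+1 (upd m r (m a - m b))
  | ILoad r a => RamState p.+1 (upd m r (m (m a)))
  | IStore a r => RamState p.+1 (upd m (m a) (m r))
  | IJz r l => if m r == 0 then RamState l m else RamState p.+1 m
  | IJmp l => RamState l m
  | IHalt => s
  end.

(* exec prog t s = Some out  iff the program, started in s, reaches a
   halting instruction (IHalt, or a pc outside the program) after at most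
   t steps, with output out = R[0] at that moment. *)
Fixpoint exec (prog : seq instr) (fuel : nat) (s : ram_state) : option nat :=
  match nth IHalt prog (pc s) with
  | IHalt => Some (mem s 0)
  | i => match fuel with
         | 0 => None
         | f.+1 => exec prog f (step_instr i s)
         end
  end.

Definition init_state (L : seq nat) : ram_state :=
  RamState 0 (fun x => if x is x'.+1 then nth 0 L x' else size L).

Definition enc_pairs n (s : seq ('I_n * 'I_n)) : seq nat :=
  size s :: flatten [seq [:: val e.1; val e.2] | e <- s].

Definition encode n (G : mixed_graph n) (P : {set 'I_n * 'I_n}) : seq nat :=
  n :: enc_pairs (medges G) ++ enc_pairs (marcs G) ++ enc_pairs (enum P).

(* Main.v *)
Require Import Defs.
From mathcomp Require Import all_boot zify.
Set Implicit Arguments. Unset Strict Implicit. Unset Printing Implicit Defensive.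

(* Let M be the digraph obtained from G by replacing every undirected edge by
   both of its directions, and say that a pair (x, y) needs a direction of an
   edge if every xy-walk of M uses it. Pairs whose two nodes lie in a common
   strong component of M can be realised by one orientation as soon as no edge
   is needed in both directions: take an inclusion-minimal set of edge
   directions that meets every edge and still connects all the pairs whose
   needs, on bridges, are among the needs of the given pairs; minimality
   forces it to contain each edge in one direction only.

   A path of M never returns to a strong component it has left. So play a game
   with one token per pair of P: a step chooses a strong component that is not
   reachable from any unfinished token outside of it, moves the unfinished
   tokens inside it to new nodes of that component, with no edge needed in both
   directions, and from there along an arc out of the component unless they are
   at their target. G is P-orientable iff the tokens can be brought from the
   sources to the targets of the pairs. The game has n^|P| positions, so its
   reachability relation is computed by saturation in time n^O(|P|).

   The program is written in a loop language in which every loop is bounded by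
   a variable that it does not modify; its running time is then polynomial, of
   a degree given by the nesting depth, in the largest loop bound, and this is
   preserved by a compilation to the RAM. *)

(** * Directions of edges and bridges *)

Lemma connect_left_ind (T : finType) (e : rel T) (y : T) (Q : T -> Prop) :
  Q y -> (forall x x', e x x' -> connect e x' y -> Q x' -> Q x) ->
  forall x, connect e x y -> Q x.
Proof.
move=> Q0 QS x /connectP[s]; elim: s x => [|x' s IH] x /=; first by move=> _ <-.
move=> /andP[exx' ps] ey; apply: QS exx' _ (IH _ ps ey).
by apply/connectP; exists s.
Qed.

(** If every step of an [e]-path could be replaced by an [f]-path, the replacements would
    concatenate to an [f]-path from [a] to [b]. *)
Lemma connect_break (T : finType) (e : rel T) (f : rel T) a b :
  connect e a b -> ~~ connect f a b ->
  exists u v, [/\ e u v, connect e a u, connect e v b & ~~ connect f u v].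
Proof.
move: a; apply: connect_left_ind => [|a a' eaa' ab IH]; first by rewrite connect0.
case: (boolP (connect f a a')) => [faa' nf|nf _].
  case: IH => [|u [v [h1 h2 h3 h4]]].
    by apply: contra nf; apply: connect_trans.
  by exists u, v; split=> //; apply: connect_trans (connect1 eaa') h2.
by exists a, a'; split=> //; apply: connect0.
Qed.

Section MixedReach.
Variables (n : nat) (G : mixed_graph n).
Notation m := (size (medges G)).
Implicit Types (S D : {set 'I_m * bool}) (p q : 'I_m * bool) (x y z : 'I_n).

(** A pair (edge index, boolean) is one direction of an edge, [true] meaning as stored. Indexing by
    position keeps parallel edges apart. *)
Definition dir p : 'I_n * 'I_n :=
  let e := tnth (in_tuple (medges G)) p.1 in if p.2 then e else (e.2, e.1).

Definition opp p := (p.1, ~~ p.2).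

Lemma oppK : involutive opp.
Proof. by case=> e b; rewrite /opp negbK. Qed.

Lemma opp_neq p : (opp p == p) = false.
Proof. by case: p => e [] ; rewrite /opp xpair_eqE eqxx. Qed.

Lemma dir_opp p : dir (opp p) = ((dir p).2, (dir p).1).
Proof. by case: p => e [] /=; rewrite /dir /=; case: (tnth _ _). Qed.

(** All arcs are present, and of the edges only the directions in [S]; [S = setT] gives the digraph
    M. *)
Definition gr S : rel 'I_n :=
  fun x y => ((x, y) \in marcs G) || [exists p in S, dir p == (x, y)].

Definition rch S := connect (gr S).

Lemma gr_sub S1 S2 : S1 \subset S2 -> subrel (gr S1) (gr S2).
Proof.
move=> sS x y; rewrite /gr => /orP[->//|/existsP[p /andP[pS e]]].
by apply/orP; right; apply/existsP; exists p; rewrite (subsetP sS).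
Qed.

Lemma rch_sub S1 S2 : S1 \subset S2 -> subrel (rch S1) (rch S2).
Proof.
by move=> sS; apply: connect_sub => x y h; apply: connect1; apply: gr_sub h.
Qed.

Lemma rchT S : subrel (rch S) (rch setT).
Proof. by apply: rch_sub; apply: subsetT. Qed.

Lemma rch_trans S y x z : rch S x y -> rch S y z -> rch S x z.
Proof. exact: connect_trans. Qed.

Lemma gr_dir S p : p \in S -> gr S (dir p).1 (dir p).2.
Proof.
move=> pS; apply/orP; right; apply/existsP; exists p.
by rewrite pS -surjective_pairing eqxx.
Qed.

Lemma rch_dir S p : p \in S -> rch S (dir p).1 (dir p).2.
Proof. by move/gr_dir/connect1. Qed.

Lemma grP S x y :
  gr S x y -> (x, y) \in marcs G \/ exists2 p, p \in S & dir p = (x, y).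
Proof.
by case/orP=> [|/existsP[p /andP[pS /eqP]]]; [left | right; exists p].
Qed.

Definition cut S p := S :\: [set p; opp p].

Lemma cut_sub S p : cut S p \subset S :\ p.
Proof. by apply/subsetP=> q; rewrite !inE negb_or => /andP[/andP[-> _] ->]. Qed.

Lemma cut_sub_opp S p : cut S p \subset S :\ opp p.
Proof. by apply/subsetP=> q; rewrite !inE negb_or => /andP[/andP[_ ->] ->]. Qed.

(** A walk needs to traverse the edge of [p] at most once: of two traversals in the same direction
    only the later is kept, and two opposite ones cancel together with what lies between them. *)
Lemma rch_cut S p x y : rch S x y ->
  [\/ rch (cut S p) x y,
      [/\ p \in S, rch (cut S p) x (dir p).1 & rch (cut S p) (dir p).2 y]
    | [/\ opp p \in S, rch (cut S p) x (dir p).2 & rch (cut S p) (dir p).1 y]].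
Proof.
have c0 z : rch (cut S p) z z by apply: connect0.
move: x; apply: connect_left_ind => [|x x' gx _ IH]; first by constructor 1.
case: (boolP (gr (cut S p) x x')) => [/connect1 g'|ng].
  case: IH => [h|[pS h1 h2]|[pS h1 h2]].
  - by constructor 1; apply: rch_trans h.
  - by constructor 2; split=> //; apply: rch_trans h1.
  - by constructor 3; split=> //; apply: rch_trans h1.
case/grP: gx => [a|[q qS dq]]; first by case/negP: ng; apply/orP; left.
have : q \notin cut S p.
  by apply: contra ng => /gr_dir; rewrite dq.
rewrite !inE qS andbT negbK => /orP[] /eqP eq; subst q.
- rewrite dq /=; case: IH => [h|[_ h1]|[_ h1]]; rewrite ?dq /= => *.
  + by constructor 2.
  + by constructor 2.
  + by constructor 1.
- have dp : dir p = (x', x) by rewrite -[p]oppK dir_opp dq.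
  rewrite dp /=; case: IH => [h|[_ h1]|[_ h1]]; rewrite ?dp /= => *.
  + by constructor 3.
  + by constructor 1.
  + by constructor 3.
Qed.

Lemma rch_split S p x y : rch S x y ->
  rch (S :\ p) x y \/
  [/\ p \in S, rch (cut S p) x (dir p).1 & rch (cut S p) (dir p).2 y].
Proof.
case/(rch_cut p) => [h|h|[pS h1 h2]]; [left|by right|left].
  exact: rch_sub (cut_sub S p) _ _ h.
apply: rch_trans (rch_sub (cut_sub S p) h1) _.
apply: rch_trans (rch_sub (cut_sub S p) h2).
have := @rch_dir (S :\ p) (opp p); rewrite dir_opp; apply.
by rewrite !inE opp_neq.
Qed.

Definition need p x y := ~~ rch (setT :\ p) x y.

Definition bridge p := need p (dir p).1 (dir p).2 && need (opp p) (dir p).2 (dir p).1.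

Lemma bridge_opp p : bridge (opp p) = bridge p.
Proof. by rewrite /bridge oppK dir_opp /= andbC. Qed.

Lemma needP p x y : rch setT x y -> need p x y ->
  rch (cut setT p) x (dir p).1 /\ rch (cut setT p) (dir p).2 y.
Proof. by move=> /(rch_split p)[h|[]//]; rewrite /need h. Qed.

(** A return walk from [b] to [a] avoiding [opp p] would bypass [opp p]. So it splits at [opp p],
    and then a walk from [a] to [b] avoiding [p] would bypass [p]; either contradicts the bridge
    property. *)
Lemma bridge_need p a b : bridge p -> rch setT b a ->
  rch (cut setT p) a (dir p).1 -> rch (cut setT p) (dir p).2 b -> need p a b.
Proof.
move=> /andP[n1 n2] ba h1 h2; apply/negP => ab.
have [h|[_]] := rch_split (opp p) ba.
  case/negP: n2; apply: rch_trans (rch_sub (cut_sub_opp _ _) h2) _.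
  by apply: rch_trans h _; apply: rch_sub (cut_sub_opp _ _) _ _ h1.
rewrite dir_opp /= => h3 h4.
have c : cut setT (opp p) \subset setT :\ p.
  by have := cut_sub_opp setT (opp p); rewrite oppK.
case/negP: n1; apply: rch_trans (rch_sub c h4) _.
by apply: rch_trans ab _; apply: rch_sub c _ _ h3.
Qed.

(** * Orienting the edges for pairs inside strong components *)

Section Orient.
Variables (k : nat) (xs ys : 'I_k -> 'I_n).

Definition noconf := [forall e : 'I_m, ~~ ([exists j, need (e, true) (xs j) (ys j)]
                                       && [exists j, need (e, false) (xs j) (ys j)])].

Hypotheses (nc : noconf) (xy : forall j, rch setT (xs j) (ys j))
  (yx : forall j, rch setT (ys j) (xs j)).

Definition allowed (ab : 'I_n * 'I_n) :=
  [&& rch setT ab.1 ab.2, rch setT ab.2 ab.1 &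
   [forall p, bridge p && need p ab.1 ab.2 ==> [exists j, need p (xs j) (ys j)]]].

Definition good D := [forall e : 'I_m, ((e, true) \in D) || ((e, false) \in D)]
                     && [forall ab, allowed ab ==> rch D ab.1 ab.2].

(** An edge needed in both directions is a bridge, since a detour between its ends could be spliced
    into the walk of one of the pairs. Both needs are then inherited by given pairs, which [nc]
    forbids. *)
Lemma noconf_allowed p ab cd : allowed ab -> allowed cd ->
  need p ab.1 ab.2 -> need (opp p) cd.1 cd.2 -> False.
Proof.
case/and3P=> ab1 _ /forallP/(_ p) abp /and3P[cd1 _ /forallP/(_ (opp p)) cdp] n1 n2.
have bp : bridge p.
  have [h1 h2] := needP ab1 n1; have [h3 h4] := needP cd1 n2.
  apply/andP; split.
    apply: contra n1 => h; apply: rch_trans (rch_sub (cut_sub _ _) h1) _.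
    by apply: rch_trans h (rch_sub (cut_sub _ _) h2).
  apply: contra n2 => h; apply: rch_trans (rch_sub (cut_sub _ _) h3) _.
  by rewrite dir_opp in h4 *; apply: rch_trans h (rch_sub (cut_sub _ _) h4).
move: abp cdp; rewrite bridge_opp bp n1 n2 /= => ex1 ex2.
by case: p ex1 ex2 {n1 n2 bp} => e [] /= ex1 ex2;
   move/forallP/(_ e): nc; rewrite ex1 ex2.
Qed.

(* Along a path of M that avoids p, some step (u, v) is only possible in D through
   p; then D contains the reverse of the edge of that step, which closes a path
   from the head of p back to its tail. *)
Lemma good_rev D p a b : good D -> p \in D -> opp p \in D -> allowed (a, b) ->
  rch (setT :\ p) a b -> ~~ rch (D :\ p) a b ->
  rch (D :\ opp p) (dir p).2 (dir p).1.
Proof.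
move=> /andP[/forallP cov /forallP gD] pD opD al ab nab.
(* By minimality, every walk from [a] to [b] in [S] uses each direction of [S]. *)
have [S /minsetP[/andP[pS Sab] minS]] :
    {S | minset (fun S => (p \notin S) && rch S a b) S}.
  by apply: ex_minset; exists (setT :\ p); rewrite !inE eqxx.
have [u [v [guv au vb nuv]]] := connect_break Sab nab.
have /and3P[/= abT baT /forallP/= al3] := al.
have vuT : rch setT v u.
  exact: rch_trans (rchT vb) (rch_trans baT (rchT au)).
have uvT : rch setT u v by apply: (@rchT S); apply: connect1.
(* A direction needed by [(u, v)] can only be the direction [q] of this step. Minimality of [S]
   splits the walk from [a] to [b] at [q], so by [bridge_need] a bridge [q] is also needed by the
   allowed pair [(a, b)]. *)
have auv : allowed (u, v).
  rewrite /allowed /= uvT vuT /=; apply/forallP => r; apply/implyP => /andP[br nr].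
  case/grP: guv => [A|[q qS dq]].
    by case/negP: nr; apply: connect1; apply/orP; left.
  case: (eqVneq q r) => [?|qr]; last first.
    by case/negP: nr; move: (@rch_dir (setT :\ r) q); rewrite dq; apply; rewrite !inE qr.
  subst r; apply: (implyP (al3 q)); rewrite br /=.
  have [h|[_ h1 h2]] := rch_split q Sab.
    have /minS : (p \notin S :\ q) && rch (S :\ q) a b.
      by rewrite h andbT !inE (negbTE pS) andbF.
    by move=> /(_ (subD1set _ _)) e; move: qS; rewrite -e !inE eqxx.
  have sc : cut S q \subset cut setT q by apply: setSD; apply: subsetT.
  by apply: bridge_need => //; [apply: rch_sub sc _ _ h1|apply: rch_sub sc _ _ h2].
have /= uvD := implyP (gD (u, v)) auv.
have [h|[_ h1 h2]] := rch_split p uvD; first by rewrite -/(rch _ _ _) h in nuv.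
case/grP: guv => [A|[q qS dq]].
  by case/negP: nuv; apply: connect1; apply/orP; left.
have qp : q != p by apply: contraNneq pS => <-.
have qD : q \notin D.
  apply: contra nuv => qD; move: (@rch_dir (D :\ p) q); rewrite dq; apply.
  by rewrite !inE qp.
have oqD : opp q \in D.
  by move: (cov q.1) qD; case: (q) => e [] /=; rewrite /opp /=; case: (_ \in D); case: (_ \in D).
apply: rch_trans (rch_sub (cut_sub_opp _ _) h2) _.
apply: rch_trans (rch_sub (cut_sub_opp _ _) h1).
move: (@rch_dir (D :\ opp p) (opp q)); rewrite dir_opp dq; apply.
by rewrite !inE oqD andbT (can_eq oppK).
Qed.

(** By minimality, dropping either of [p] and [opp p] breaks an allowed pair. Each broken pair turns
    out to need the dropped direction, which [noconf_allowed] excludes. *)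
Lemma good_min_neq D p : minset good D -> p \in D -> opp p \in D -> False.
Proof.
move=> /minsetP[gD minD].
have w q : q \in D -> opp q \in D ->
    exists2 ab, allowed ab & ~~ rch (D :\ q) ab.1 ab.2.
  move=> qD oqD.
  case: (boolP (good (D :\ q))) => [/minD|].
    by move=> /(_ (subD1set _ _)) e; move: qD; rewrite -e !inE eqxx.
  rewrite /good negb_and => /orP[]; last first.
    by move=> /forallPn[ab]; rewrite negb_imply => /andP[h1 h2]; exists ab.
  case/negP; apply/forallP=> e; have /andP[/forallP/(_ e) c _] := gD.
  rewrite !inE; case: q qD oqD c => e' b; rewrite /opp /= !xpair_eqE.
  case: (eqVneq e e') => [<-|] //=; first by case: b => /= -> -> /=.
(* If the broken pair did not need [q], [good_rev] would give a detour around [opp q] inside [D],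
   and dropping [opp q] would break no pair. *)
have key q a b : good D -> q \in D -> opp q \in D -> allowed (a, b) ->
    ~~ rch (D :\ q) a b -> ~~ need q a b -> False.
  move=> _ qD oqD al nab; rewrite negbK => ab.
  have h := good_rev gD qD oqD al ab nab.
  have [[c d] /= acd ncd] := w (opp q) oqD (etrans (congr1 _ (oppK q)) qD).
  have cd : rch D c d by have /andP[_ /forallP/(_ (c, d))] := gD; rewrite acd.
  have [h'|[_]] := rch_split (opp q) cd; first by rewrite h' in ncd.
  rewrite dir_opp /= => h1 h2; case/negP: ncd.
  apply: rch_trans (rch_sub (cut_sub _ _) h1) _.
  exact: rch_trans h (rch_sub (cut_sub _ _) h2).
move=> pD oD; have [[a b] /= aab nab] := w _ pD oD.
have poD : opp (opp p) \in D by rewrite oppK.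
have [[c d] /= acd ncd] := w _ oD poD.
case: (boolP (need p a b)) => [n1|]; last exact: key nab.
case: (boolP (need (opp p) c d)) => [n2|]; last exact: key ncd.
exact: (noconf_allowed aab acd n1 n2).
Qed.

Definition oset (o : 'I_m -> bool) : {set 'I_m * bool} := [set p | p.2 == o p.1].

(** A minimal good set has exactly one direction of each edge, hence lies in an orientation; the
    given pairs are themselves allowed, so it connects them. *)
Lemma noconf_orient : exists o, forall j, rch (oset o) (xs j) (ys j).
Proof.
have gT : good setT.
  apply/andP; split; first by apply/forallP=> e; rewrite inE.
  by apply/forallP=> ab; apply/implyP=> /and3P[].
have [D mD] : {D | minset good D} by apply: ex_minset; exists setT.
have /minsetP[/andP[/forallP cov /forallP gD] _] := mD.
exists (fun e => (e, true) \in D) => j.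
have al : allowed (xs j, ys j).
  rewrite /allowed /= xy yx /=; apply/forallP => p; apply/implyP=> /andP[_ h].
  by apply/existsP; exists j.
have /= h := implyP (gD _) al; apply: rch_sub h.
apply/subsetP=> -[e b] pD; rewrite inE /=.
have := cov e; case: b pD => pD; rewrite ?pD //= ?orbT => _.
case: (boolP ((e, true) \in D)) => // tD.
by case: (@good_min_neq D (e, true)).
Qed.

End Orient.

Lemma need_oset o p x y : rch (oset o) x y -> need p x y -> p.2 = o p.1.
Proof.
move=> xy np; apply: contraTeq xy => po; apply: contra np.
apply: rch_sub; apply/subsetP=> q; rewrite !inE andbT.
by apply: contraTneq => ->.
Qed.

Lemma oset_noconf k (xs ys : 'I_k -> 'I_n) o :
  (forall j, rch (oset o) (xs j) (ys j)) -> noconf xs ys.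
Proof.
move=> h; apply/forallP=> e; apply/negP=> /andP[/existsP[i /need_oset ni] /existsP[j /need_oset nj]].
by move: (ni _ (h i)) (nj _ (h j)) => /= <-.
Qed.

End MixedReach.

(** * The token game *)

Lemma connect_exit (T : finType) (e : rel T) (R : pred T) (t x : T) :
  connect e x t -> R x ->
  exists y, [/\ R y, connect e x y &
    y = t \/ exists z, [/\ ~~ R z, e y z & connect e z t]].
Proof.
move: x; apply: connect_left_ind => [Rt|x x' exx' xt IH Rx].
  by exists t; split=> //; left.
case: (boolP (R x')) => [/IH[y [Ry x'y h]]|nR].
  by exists y; split=> //; apply: connect_trans (connect1 exx') x'y.
by exists x; split=> //; right; exists x'.
Qed.

Section Game.
Variables (n : nat) (G : mixed_graph n) (k : nat).
Notation m := (size (medges G)).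
Notation gr := (@gr n G).
Notation rch := (@rch n G).
Notation rT := (rch setT).

(* In a step at the strong component of w, a token at x either stays (then it has
   arrived or can no longer reach w) or moves inside the component to y and from
   there to z outside of it, or stops at y = z = t. *)
Definition okmove (w x y z t : 'I_n) :=
  ((x == y) && (y == z) && ((x == t) || ~~ rT x w)) ||
  [&& rT x w, rT w x, rT y w, rT w y &
    ((z == y) && (y == t)) || (gr setT y z && ~~ rT z w)].

Variables (X : finType) (dec : X -> 'I_k -> 'I_n).
Hypothesis dec_surj : forall f : 'I_k -> 'I_n, exists x, dec x =1 f.
Variables (s t : 'I_k -> 'I_n).

(** Positions are abstract codes [X] of token vectors, so that numbers in base n can be substituted
    for them later. *)
Definition gstep (x z : X) :=
  [exists w, exists y, [forall j, okmove w (dec x j) (dec y j) (dec z j) (t j)]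
                       && noconf G (dec x) (dec y)].

Definition orients o (xs ys : 'I_k -> 'I_n) := forall j, rch (oset o) (xs j) (ys j).

(** Edges in the component of [w] are oriented by [noconf_orient], all others as in the orientation
    for [z]. The two do not interfere, as no token that still has to travel outside can come back to
    the component. *)
Lemma gstep_orients x z :
  gstep x z -> (exists o, orients o (dec z) t) -> exists o, orients o (dec x) t.
Proof.
case/existsP=> w /existsP[y /andP[/forallP ok nc]] [o' zt].
have [] := noconf_orient nc.
- move=> j; case/orP: (ok j) => [/andP[/andP[/eqP-> _] _]|/and5P[h1 h2 h3 h4 _]].
    exact: connect0.
  exact: rch_trans h1 h4.
- move=> j; case/orP: (ok j) => [/andP[/andP[/eqP-> _] _]|/and5P[h1 h2 h3 h4 _]].
    exact: connect0.
  exact: rch_trans h3 h2.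
move=> o xy.
pose R u := rT u w && rT w u.
pose oo e := if R (dir (G := G) (e, true)).1 then o e else o' e.
exists oo => j.
(* A walk of M between two nodes of the component stays inside it, so [oo] agrees with [o] on its
   edges. *)
have inR a b : R a -> R b -> rch (oset o) a b -> rch (oset oo) a b.
  move=> Ra /andP[bw _] ab; move: a ab Ra; apply: connect_left_ind => [|a a' ga a'b IH Ra].
    by move=> _; apply: connect0.
  have aa' : rT a a' by apply: (@rchT _ _ (oset o)); apply: connect1.
  have Ra' : R a'.
    case/andP: Ra => _ wa; rewrite /R (rch_trans (rchT a'b) bw).
    by rewrite (rch_trans wa aa').
  apply: rch_trans (IH Ra'); apply: connect1.
  case/grP: ga => [A|[p]]; first by apply/orP; left.
  rewrite inE => /eqP po dp; rewrite -[a]/((a, a').1) -[a' in gr _ _ a']/((a, a').2) -dp.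
  apply: gr_dir; rewrite inE /oo po.
  suff -> : R (dir (G := G) (p.1, true)).1 by [].
  case: p dp {po} => e [] /= dp; first by rewrite dp.
  by rewrite -[(e, true)]/(opp (e, false)) dir_opp dp.
(* A walk from a node that cannot reach [w] never meets the component, so [oo] agrees with [o'] on
   its edges. *)
have outR a b : ~~ rT a w -> rch (oset o') a b -> rch (oset oo) a b.
  move=> nR ab; move: a ab nR; apply: connect_left_ind => [|a a' ga a'b IH nR].
    by move=> _; apply: connect0.
  have aa' : rT a a' by apply: (@rchT _ _ (oset o')); apply: connect1.
  have nR' : ~~ rT a' w by apply: contra nR; apply: rch_trans.
  apply: rch_trans (IH nR'); apply: connect1.
  case/grP: ga => [A|[p]]; first by apply/orP; left.
  rewrite inE => /eqP po dp; rewrite -[a]/((a, a').1) -[a' in gr _ _ a']/((a, a').2) -dp.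
  apply: gr_dir; rewrite inE /oo po.
  suff -> : R (dir (G := G) (p.1, true)).1 = false by [].
  case: p dp {po} => e [] /= dp; first by rewrite dp /R (negbTE nR).
  by rewrite -[(e, true)]/(opp (e, false)) dir_opp dp /R (negbTE nR').
case/orP: (ok j) => [/andP[/andP[/eqP exy /eqP eyz]]|].
  case/orP => [/eqP ->|nR]; first exact: connect0.
  by apply: outR => //; rewrite exy eyz; apply: zt.
case/and5P=> h1 h2 h3 h4 h5.
have xy' : rch (oset oo) (dec x j) (dec y j) by apply: inR => //; rewrite /R ?h1 ?h3.
case/orP: h5 => [/andP[/eqP _ /eqP <-] //|/andP[gyz nR]].
apply: rch_trans xy' _; apply: rch_trans (outR _ _ nR (zt j)); apply: connect1.
(* The exit step is an arc of [G]: the reverse of an edge would lead from [z] back to the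
   component. *)
case/grP: gyz => [A|[p _ dp]]; first by apply/orP; left.
case/negP: nR; apply: rch_trans h3.
by have := @rch_dir _ G setT (opp p); rewrite dir_opp dp inE; apply.
Qed.

(** Termination measure: a token that leaves a component loses its nodes for good, and a token that
    arrives counts 0. *)
Definition potential (x : X) := \sum_j (if dec x j == t j then 0 else #|rT (dec x j)|).

Lemma orients_gstep o x : orients o (dec x) t -> (exists j, dec x j != t j) ->
  exists z, [/\ gstep x z, orients o (dec z) t & potential z < potential x].
Proof.
move=> xt [j0 nj0].
(* With the largest reachable set chosen, an unfinished token that reaches [w] has the same
   reachable set, and so lies in the component of [w]. *)
have [jw njw maxw] := @arg_maxnP _ j0 (fun j => dec x j != t j) (fun j => #|rT (dec x j)|) nj0.
pose w := dec x jw; pose R u := rT u w && rT w u.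
have xR j : dec x j != t j -> rT (dec x j) w -> R (dec x j).
  move=> nj xw; rewrite /R xw /=.
  have sub : rT w \subset rT (dec x j).
    by apply/subsetP=> u wu; apply: rch_trans xw wu.
  have : #|rT w| == #|rT (dec x j)|.
    by rewrite eqn_leq (subset_leq_card sub); apply: maxw.
  rewrite (subset_leqif_card sub) => /subsetP/(_ (dec x j)); apply.
  exact: connect0.
(* Unfinished tokens of the component follow their path in [o] to the target or to the first step
   out of the component; the others stay. *)
have mv j : exists yz : 'I_n * 'I_n,
    [/\ okmove w (dec x j) yz.1 yz.2 (t j), rch (oset o) (dec x j) yz.1,
        rch (oset o) yz.2 (t j) &
        (if (dec x j != t j) && R (dec x j) then
          (yz.2 = t j \/ ~~ rT yz.2 w /\ rT w yz.2) else yz.2 = dec x j)].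
  case: (boolP ((dec x j != t j) && R (dec x j))) => [/andP[nj Rj]|nmv]; last first.
    exists (dec x j, dec x j); split=> //=; last exact: connect0.
    rewrite /okmove !eqxx /=; case: eqP nmv => //= /eqP nj nmv.
    by rewrite (contra (xR _ nj) nmv).
  have [y [Ry xy h]] := connect_exit (xt j) Rj.
  case/andP: (Rj) => xw wx; case/andP: (Ry) => yw wy.
  case: h => [?|[z [nRz gyz zt]]].
    subst y; exists (t j, t j); split=> //=; [|exact: connect0|by left].
    by rewrite /okmove xw wx yw wy !eqxx !orbT.
  have gyz' := gr_sub (subsetT _) gyz.
  have wz : rT w z by apply: rch_trans wy (connect1 gyz').
  have zw : ~~ rT z w by move: nRz; rewrite /R wz andbT.
  by exists (y, z); split=> //=; [rewrite /okmove xw wx yw wy gyz' zw !orbT|right].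
have /fin_all_exists[f fP] := mv.
have [z zf] := dec_surj (fun j => (f j).2).
have [y yf] := dec_surj (fun j => (f j).1).
exists z; split.
- apply/existsP; exists w; apply/existsP; exists y; apply/andP; split.
    by apply/forallP=> j; rewrite zf yf; case: (fP j).
  by apply: (@oset_noconf _ _ _ _ _ o) => j; rewrite yf; case: (fP j).
- by move=> j; rewrite zf; case: (fP j).
rewrite /potential (bigD1 jw) //= [in X in _ < X](bigD1 jw) //= -addSn.
apply: leq_add.
  rewrite (negbTE njw) zf; case: (fP jw) => _ _ _.
  rewrite -/w in njw *; rewrite njw /R /rch connect0 /= => h.
  case: ifP => [_|/eqP nt]; first by apply/card_gt0P; exists w; apply: connect0.
  case: h => [//|[zw wz]]; apply: proper_card; apply/properP; split.
    by apply/subsetP=> u; apply: rch_trans.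
  by exists w => //; apply: connect0.
apply: leq_sum => j _; rewrite zf; case: (fP j) => _ _ _.
case: ifP => [/andP[nj Rj]|_ ->] //.
case=> [->|[zw wz]]; first by rewrite eqxx.
case: ifP => // _; rewrite (negbTE nj); apply: subset_leq_card.
by apply/subsetP=> u h; apply: rch_trans h; apply: rch_trans wz; case/andP: Rj.
Qed.

(** Forward, steps are iterated by induction on the potential. Backward, any orientation serves at
    the targets, and [gstep_orients] pulls an orientation back step by step. *)
Lemma orientable_connect : (exists o, orients o s t) <->
  exists x0 x, [/\ dec x0 =1 s, dec x =1 t & connect gstep x0 x].
Proof.
split.
  case=> o st; have [x0 e0] := dec_surj s; exists x0.
  have {}st : orients o (dec x0) t by move=> j; rewrite e0.
  suff [x []] : exists x, dec x =1 t /\ connect gstep x0 x by exists x.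
  move: {2}_.+1 (ltnSn (potential x0)) => N; elim: N x0 st {e0} => // N IH x0 st ltN.
  case: (boolP [forall j, dec x0 j == t j]) => [/forallP h|/forallPn nd].
    by exists x0; split=> [j|]; [apply/eqP|apply: connect0].
  have [z [g zt lt]] := orients_gstep st nd.
  have [x [xt' zx]] := IH _ zt (leq_trans lt ltN).
  by exists x; split=> //; apply: connect_trans (connect1 g) zx.
case=> x0 [x [e0 xt c]].
suff [o ho] : exists o, orients o (dec x0) t by exists o => j; rewrite -e0.
move: x0 c {e0}; apply: connect_left_ind => [|y y' gy _ IH].
  by exists (fun _ => true) => j; rewrite xt; apply: connect0.
exact: gstep_orients gy IH.
Qed.

End Game.

Lemma orient_gr n (G : mixed_graph n) o x y :
  ((x, y) \in orient o) = gr (G := G) (oset o) x y.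
Proof.
rewrite /orient mem_cat /gr; congr (_ || _).
have -> : zip (medges G) (codom o) =
    [seq (tnth (in_tuple (medges G)) i, o i) | i <- enum 'I_(size (medges G))].
  have e1 : medges G = map (tnth (in_tuple (medges G))) (enum 'I_(size (medges G))).
    by rewrite map_tnth_enum.
  rewrite [X in zip X _]e1 codomE /=.
  by elim: (enum _) => //= i s ->.
rewrite -map_comp; apply/mapP/existsP => [[i _ e]|[[i b]]].
  by exists (i, o i); rewrite inE eqxx /= e.
rewrite inE /= => /andP[/eqP-> /eqP e]; exists i; first by rewrite mem_enum.
by rewrite -e.
Qed.

Lemma P_orientableE n (G : mixed_graph n) (P : {set 'I_n * 'I_n}) :
  P_orientable G P <->
  exists o : 'I_(size (medges G)) -> bool, forall p, p \in P -> rch (oset o) p.1 p.2.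
Proof.
have E o : satisfies (orient (G := G) o) P = [forall p in P, rch (oset o) p.1 p.2].
  rewrite /satisfies /sat_pairs.
  have -> : [set p in P | has_path (orient (G := G) o) p.1 p.2] =
            [set p in P | rch (oset o) p.1 p.2].
    by apply/setP=> p; rewrite !inE /has_path (eq_connect (orient_gr o)).
  apply/eqP/forall_inP => [<- p|h]; first by rewrite inE => /andP[].
  by apply/setP=> p; rewrite inE; case: (boolP (p \in P)) => //= /h ->.
split=> [/existsP[o]|[o h]].
  by rewrite E => /forall_inP h; exists o.
apply/existsP; exists (finfun o); rewrite E; apply/forall_inP=> p /h.
by apply: rch_sub; apply/subsetP=> q; rewrite !inE ffunE.
Qed.

(** * A loop language and its semantics *)

(** Bounded sums together with truncated subtraction express products, quotients and bounded
    quantifiers. *)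
Inductive expr :=
| Cst (k : nat)
| Var (r : nat)
| Plus (e1 e2 : expr)
| Minus (e1 e2 : expr)
| Get (a : nat) (e : expr)
| Sum (i b : nat) (e : expr).

Inductive cmd :=
| Assign (r : nat) (e : expr)
| Store (a : nat) (e1 e2 : expr)
| Seq (c1 c2 : cmd)
| For (i b : nat) (c : cmd).

Fixpoint eval (v : nat -> nat) (A : nat -> nat -> nat) (e : expr) : nat :=
  match e with
  | Cst k => k
  | Var r => v r
  | Plus e1 e2 => eval v A e1 + eval v A e2
  | Minus e1 e2 => eval v A e1 - eval v A e2
  | Get a e => A a (eval v A e)
  | Sum i b e => \sum_(0 <= k < v b) eval (upd v i k) A e
  end.

Definition state := ((nat -> nat) * (nat -> nat -> nat))%type.

Definition setv i k (s : state) : state := (upd s.1 i k, s.2).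
Definition seta a x y (s : state) : state :=
  (s.1, fun a' => if a' == a then upd (s.2 a) x y else s.2 a').

(** The counter of a [For] ends equal to the bound, as it does after the compiled loop. *)
Fixpoint sem (c : cmd) (s : state) : state :=
  match c with
  | Assign r e => setv r (eval s.1 s.2 e) s
  | Store a e1 e2 => seta a (eval s.1 s.2 e1) (eval s.1 s.2 e2) s
  | Seq c1 c2 => sem c2 (sem c1 s)
  | For i b c => setv i (s.1 b) (iteri (s.1 b) (fun k s => sem c (setv i k s)) s)
  end.

Fixpoint fv e := match e with
  | Cst _ => [::]
  | Var r => [:: r]
  | Plus e1 e2 | Minus e1 e2 => fv e1 ++ fv e2
  | Get _ e => fv e
  | Sum i b e => b :: [seq r <- fv e | r != i]
  end.

Fixpoint bv e := match e with
  | Cst _ | Var _ => [::]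
  | Plus e1 e2 | Minus e1 e2 => bv e1 ++ bv e2
  | Get _ e => bv e
  | Sum i b e => i :: bv e
  end.

Fixpoint bnde e := match e with
  | Cst _ | Var _ => [::]
  | Plus e1 e2 | Minus e1 e2 => bnde e1 ++ bnde e2
  | Get _ e => bnde e
  | Sum i b e => b :: bnde e
  end.

Fixpoint modv c := match c with
  | Assign r _ => [:: r]
  | Store _ _ _ => [::]
  | Seq c1 c2 => modv c1 ++ modv c2
  | For i _ c => i :: modv c
  end.

Fixpoint moda c := match c with
  | Assign _ _ => [::]
  | Store a _ _ => [:: a]
  | Seq c1 c2 => moda c1 ++ moda c2
  | For _ _ c => moda c
  end.

Fixpoint bndc c := match c with
  | Assign _ e => bnde e
  | Store _ e1 e2 => bnde e1 ++ bnde e2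
  | Seq c1 c2 => bndc c1 ++ bndc c2
  | For _ b c => b :: bndc c
  end.

Lemma eval_ext v1 v2 A e : {in fv e, v1 =1 v2} -> eval v1 A e = eval v2 A e.
Proof.
elim: e v1 v2 => //= [r|e1 IH1 e2 IH2|e1 IH1 e2 IH2|a e IH|i b e IH] v1 v2 h.
- by apply: h; rewrite inE.
- by rewrite (IH1 v1 v2) ?(IH2 v1 v2) // => r rr; apply: h; rewrite mem_cat rr ?orbT.
- by rewrite (IH1 v1 v2) ?(IH2 v1 v2) // => r rr; apply: h; rewrite mem_cat rr ?orbT.
- by rewrite (IH v1 v2).
rewrite (h b) ?inE ?eqxx //; apply: eq_bigr => k _; apply: IH => r rr.
by rewrite /upd; case: eqP => // /eqP ri; apply: h; rewrite inE mem_filter ri rr orbT.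
Qed.

Lemma eval_upd v A e i k : i \notin fv e -> eval (upd v i k) A e = eval v A e.
Proof.
move=> ni; apply: eval_ext => r rr; rewrite /upd; case: eqP => // e1.
by rewrite -e1 rr in ni.
Qed.

Lemma sem_frame c s : (forall r, r \notin modv c -> (sem c s).1 r = s.1 r) /\
                      (forall a, a \notin moda c -> (sem c s).2 a = s.2 a).
Proof.
elim: c s => /= [r e|a e1 e2|c1 IH1 c2 IH2|i b c IH] s.
- by split=> // r'; rewrite inE /upd => /negbTE ->.
- by split=> // a'; rewrite inE => /negbTE ->.
- by split=> x; rewrite mem_cat negb_or => /andP[x1 x2];
    case: (IH2 (sem c1 s)) (IH1 s) => h1 h2 [h3 h4]; rewrite ?h1 ?h2 ?h3 ?h4.
split=> x.
  rewrite inE negb_or => /andP[/negbTE xi xc]; rewrite /upd xi.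
  by elim: (s.1 b) => //= L <-; case: (IH (setv i L (iteri L (fun k s => sem c (setv i k s)) s)))
    => h _; rewrite h //= /upd xi.
move=> xc; elim: (s.1 b) => //= L <-.
by case: (IH (setv i L (iteri L (fun k s => sem c (setv i k s)) s))) => _ ->.
Qed.

Lemma sem_v c s r : r \notin modv c -> (sem c s).1 r = s.1 r.
Proof. by case: (sem_frame c s); auto. Qed.

Lemma sem_a c s a : a \notin moda c -> (sem c s).2 a = s.2 a.
Proof. by case: (sem_frame c s); auto. Qed.

(** * Running straight-line code and counting loops on the RAM *)

Section Machine.
Variable prog : seq instr.

Definition runs t p (m : nat -> nat) p' m' :=
  iter t (fun s => step_instr (nth IHalt prog (pc s)) s) (RamState p m) = RamState p' m'.

(** [exec] may stop before [t] steps, but a halted state is a fixed point of the step function, so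
    the iteration still ends in it. *)
Lemma exec_runs t p m p' m' : runs t p m p' m' -> nth IHalt prog p' = IHalt ->
  exec prog t (RamState p m) = Some (m' 0).
Proof.
rewrite /runs => r h.
have -> : m' 0 = Defs.mem (RamState p' m') 0 by [].
have {}h : nth IHalt prog (pc (RamState p' m')) = IHalt by [].
move: h; rewrite -{}r; elim: t (RamState p m) => [|t IH] s; first by rewrite /= => ->.
rewrite iterSr /=; case e : (nth IHalt prog (pc s)) => /= *; try exact: IH.
suff -> : iter t (fun s => step_instr (nth IHalt prog (pc s)) s) s = s by [].
by elim: (t) => //= t' ->; rewrite e.
Qed.

Lemma runs_trans t1 t2 p1 m1 p2 m2 p3 m3 :
  runs t1 p1 m1 p2 m2 -> runs t2 p2 m2 p3 m3 -> runs (t1 + t2) p1 m1 p3 m3.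
Proof. by rewrite /runs addnC iterD => ->. Qed.

Definition code_at p (c : seq instr) :=
  forall i, i < size c -> nth IHalt prog (p + i) = nth IHalt c i.

Lemma code_at_cat p c1 c2 :
  code_at p (c1 ++ c2) -> code_at p c1 /\ code_at (p + size c1) c2.
Proof.
move=> h; split=> i ic.
  by rewrite h ?nth_cat ?ic // size_cat ltn_addr.
rewrite -addnA h ?size_cat ?ltn_add2l // nth_cat.
by rewrite ltnNge leq_addr /= addKn.
Qed.

Lemma code_at_cons p i c : code_at p (i :: c) -> nth IHalt prog p = i /\ code_at p.+1 c.
Proof.
move=> h; split; first by have := h 0 isT; rewrite addn0.
by move=> j jc; rewrite addSnnS; exact: (h j.+1).
Qed.

Definition straight i := match i with IJz _ _ | IJmp _ | IHalt => false | _ => true end.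

Definition effect (c : seq instr) m :=
  foldl (fun m i => Defs.mem (step_instr i (RamState 0 m))) m c.

Lemma runs_straight p c m : code_at p c -> all straight c ->
  runs (size c) p m (p + size c) (effect c m).
Proof.
elim: c p m => [|i c IH] p m /=; first by rewrite addn0.
move=> /code_at_cons[e ca] /andP[si sc].
rewrite -add1n addnA addn1; apply: runs_trans (IH _ _ ca sc).
by rewrite /runs /= e; case: i si {e}.
Qed.

(** Cell 0 receives the bound minus the counter and is tested for zero. The body is given its own
    address [p + 3] because jumps are absolute. *)
Definition loop p ci cb (body : nat -> seq instr) :=
  let c := body (p + 3) in
  [:: IConst ci 0; ISub 0 cb ci; IJz 0 (p + 6 + size c)] ++ c ++
  [:: IConst 1 1; IAdd ci ci 1; IJmp p.+1].

Lemma size_loop p ci cb body : size (loop p ci cb body) = 6 + size (body (p + 3)).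
Proof. by rewrite /loop /= size_cat /= addn3. Qed.

(** The invariant has to be insensitive to cells 0 and 1 and to the counter, which the loop control
    overwrites. An iteration costs 5 instructions besides the body, and 3 more pay for the
    initialisation and the last test. *)
Lemma runs_loop p ci cb body (Inv : nat -> (nat -> nat) -> Prop) L cost m :
  code_at p (loop p ci cb body) ->
  1 < ci -> 1 < cb -> ci != cb ->
  (forall k m m', Inv k m -> (forall x, 1 < x -> x != ci -> m' x = m x) -> Inv k m') ->
  (forall k m, k < L -> Inv k m -> m ci = k -> m cb = L ->
     exists t m', [/\ t <= cost, runs t (p + 3) m (p + 3 + size (body (p + 3))) m',
                      Inv k.+1 m' & m' ci = k /\ m' cb = L]) ->
  m cb = L -> Inv 0 m ->
  exists t m', [/\ t <= 3 + L * (cost + 5),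
     runs t p m (p + size (loop p ci cb body)) m',
     Inv L m' & m' ci = L].
Proof.
move=> ca ci1 cb1 cicb Iext body_ok mcb I0.
have ne x : 1 < x -> (x == 0 = false) * (x == 1 = false) by case: x => [|[]].
have [ci0 cb0] := (ne _ ci1, ne _ cb1).
rewrite size_loop; set c := body (p + 3) in ca body_ok *.
have [/code_at_cons[i0 /code_at_cons[i1 /code_at_cons[i2 _]]]] := code_at_cat ca.
case/code_at_cat=> _; rewrite -/c /=.
move=> /code_at_cons[j0 /code_at_cons[j1 /code_at_cons[j2 _]]].
rewrite -addnA in i2; set q := p + 3 + size c in j0 j1 j2 *.
have step1 : runs 1 p m p.+1 (upd m ci 0) by rewrite /runs /= i0.
(* Induction on the number [k] of iterations still to be done. *)
have main k m1 : k <= L -> Inv (L - k) m1 -> m1 ci = L - k -> m1 cb = L ->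
    exists t m', [/\ t <= 2 + k * (cost + 5),
     runs t p.+1 m1 (p + (6 + size c)) m', Inv L m' & m' ci = L].
  elim: k m1 => [|k IH] m1 kL I1 m1i m1b.
    exists 2, (upd m1 0 (L - L)); rewrite subn0 in I1 m1i; split=> //.
    - by rewrite /runs /= i1 /= i2 /= /upd /= m1b m1i subnn /= addnA.
    - by apply: Iext I1 _ => x /ne; rewrite /upd => ->.
    - by rewrite /upd ci0.
  pose m2 := upd m1 0 (L - (L - k.+1)).
  have m2E x : 1 < x -> m2 x = m1 x by move=> /ne; rewrite /m2 /upd => ->.
  have r2 : runs 2 p.+1 m1 (p + 3) m2.
    by rewrite /m2 /runs /= i1 /= i2 /= /upd /= m1b m1i subKn //= addn3.
  have lt : L - k.+1 < L by rewrite ltn_subrL; case: (L) kL.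
  have [||t [m3 [tc r3 I3 [m3i m3b]]]] := body_ok _ m2 lt _ _ (etrans (m2E _ cb1) m1b).
  - by apply: Iext I1 _ => x x1 _; apply: m2E.
  - by rewrite m2E.
  pose m4 := upd (upd m3 1 1) ci (L - k.+1).+1.
  have r4 : runs 3 q m3 p.+1 m4.
    by rewrite /runs /= j0 /= j1 /= j2 /= /m4 /upd /= ci0 /= m3i addn1.

  have e : (L - k.+1).+1 = L - k by rewrite subnSK.
  have [|||t' [m' [t'c r5 I5 m'i]]] := IH m4 (ltnW kL).
  - rewrite -e; apply: Iext I3 _ => x x1 xi.
    by rewrite /m4 /upd (negbTE xi) (ne _ x1).
  - by rewrite -e /m4 /upd eqxx.
  - by rewrite /m4 /upd eq_sym (negbTE cicb) (ne _ cb1).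
  exists (2 + t + 3 + t'), m'; split=> //; first by rewrite mulSn; lia.
  by apply: runs_trans r5; apply: runs_trans r4; apply: runs_trans r3.
have [|||t [m' [tc r I mi]]] := main L (upd m ci 0) (leqnn L); rewrite ?subnn.
- by apply: Iext I0 _ => x _ xi; rewrite /upd (negbTE xi).
- by rewrite /upd eqxx.
- by rewrite /upd eq_sym (negbTE cicb).
exists (1 + t), m'; split=> //.
exact: runs_trans step1 r.
Qed.

End Machine.

(** * Compilation to the RAM *)

(* Even cells from 4 on hold the variables, odd cells from 5 on the temporaries
   of expressions, cells 0 and 1 are scratch and cell 3 holds the base address Bs
   of the sixteen interleaved arrays: entry i of array a is at Bs + 16 * i + a. *)
Definition vr r := 4 + 2 * r.
Definition tm d := 5 + 2 * d.

(** Four doublings multiply by 16; the resulting address is left in cell 0. *)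
Definition addr r a := [:: IAdd 0 r r; IAdd 0 0 0; IAdd 0 0 0; IAdd 0 0 0;
                           IConst 1 a; IAdd 0 0 1; IAdd 0 0 3].

(** The code starts at address [p], may use the temporaries from [d] on and leaves the value in
    [tm d]. *)
Fixpoint cexp p d e : seq instr := match e with
  | Cst k => [:: IConst (tm d) k]
  | Var r => [:: IConst 0 0; IAdd (tm d) (vr r) 0]
  | Plus e1 e2 => let c1 := cexp p d e1 in let c2 := cexp (p + size c1) d.+1 e2 in
      c1 ++ c2 ++ [:: IAdd (tm d) (tm d) (tm d.+1)]
  | Minus e1 e2 => let c1 := cexp p d e1 in let c2 := cexp (p + size c1) d.+1 e2 in
      c1 ++ c2 ++ [:: ISub (tm d) (tm d) (tm d.+1)]
  | Get a e => cexp p d e ++ addr (tm d) a ++ [:: ILoad (tm d) 0]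
  | Sum i b e => IConst (tm d) 0 ::
      loop p.+1 (vr i) (vr b) (fun q => cexp q d.+1 e ++ [:: IAdd (tm d) (tm d) (tm d.+1)])
  end.

Fixpoint ccmd p c : seq instr := match c with
  | Assign r e => cexp p 0 e ++ [:: IConst 0 0; IAdd (vr r) (tm 0) 0]
  | Store a e1 e2 => let c1 := cexp p 0 e1 in let c2 := cexp (p + size c1) 1 e2 in
      c1 ++ c2 ++ addr (tm 0) a ++ [:: IStore 0 (tm 1)]
  | Seq c1 c2 => let c1 := ccmd p c1 in c1 ++ ccmd (p + size c1) c2
  | For i b c => loop p (vr i) (vr b) (fun q => ccmd q c)
  end.

(** Instruction counts of [cexp] when all loop bounds have values at most [B]. *)
Fixpoint ce B e := match e with
  | Cst _ => 1
  | Var _ => 2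
  | Plus e1 e2 | Minus e1 e2 => ce B e1 + ce B e2 + 1
  | Get _ e => ce B e + 8
  | Sum _ _ e => 4 + B * (ce B e + 6)
  end.

Fixpoint cc B c := match c with
  | Assign _ e => ce B e + 2
  | Store _ e1 e2 => ce B e1 + ce B e2 + 8
  | Seq c1 c2 => cc B c1 + cc B c2
  | For _ _ c => 3 + B * (cc B c + 5)
  end.

Section Correct.
Variables (prog : seq instr) (lim Bs B pv : nat).
Hypothesis lim_Bs : lim <= Bs.

(* The code of an expression overwrites the cells of the variables bound in it,
   hence the freshness conditions; lim bounds all the cells used. *)
Fixpoint wfe d e := match e with
  | Cst _ | Var _ => tm d < lim
  | Plus e1 e2 | Minus e1 e2 =>
      [&& wfe d e1, wfe d.+1 e2 & all (fun r => r \notin bv e1) (fv e2)]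
  | Get a e => (a < 16) && wfe d e
  | Sum i b e => [&& tm d < lim, vr i < lim, i \notin bv e, b \notin bv e,
                     i \notin bnde e, i != b, wfe d.+1 e &
                     all (fun r => r \notin bv e) (fv e)]
  end.

Definition arrs (m : nat -> nat) (A : nat -> nat -> nat) :=
  m 3 = Bs /\ forall a i, a < 16 -> m (Bs + 16 * i + a) = A a i.

(** Cells from [lim] on are protected even if they have the form [tm d'], because the arrays lie
    there. *)
Definition frame d (vs : seq nat) (m m' : nat -> nat) :=
  forall x, 1 < x -> (forall r, r \in vs -> x <> vr r) ->
  (x < lim -> forall d', d <= d' -> x <> tm d') -> m' x = m x.

Lemma wfe_lim d e : wfe d e -> tm d < lim /\ (forall r, r \in bv e -> vr r < lim).
Proof.
elim: e d => //= [e1 IH1 e2 IH2|e1 IH1 e2 IH2|a e IH|i b e IH] d.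
- case/and3P=> /IH1[h1 h2] /IH2[h3 h4] _; split=> // r.
  by rewrite mem_cat => /orP[/h2|/h4].
- case/and3P=> /IH1[h1 h2] /IH2[h3 h4] _; split=> // r.
  by rewrite mem_cat => /orP[/h2|/h4].
- by case/andP=> _ /IH.
case/and5P=> h1 h2 _ _ /and4P[_ _ /IH[_ h] _]; split=> // r.
by rewrite inE => /orP[/eqP->|/h].
Qed.

Lemma frame_arrs d vs m m' A : lim <= Bs -> 3 < lim -> (forall r, r \in vs -> vr r < lim) ->
  frame d vs m m' -> arrs m A -> arrs m' A.
Proof.
move=> lB l3 hv fr [m3 h]; split=> [|a i a16].
  by rewrite fr // => [r _|_ d' _]; rewrite /vr /tm; lia.
rewrite -h //; apply: fr; first by lia.
  by move=> r /hv; lia.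
by lia.
Qed.

Lemma frame_var d vs m m' r : frame d vs m m' -> r \notin vs -> m' (vr r) = m (vr r).
Proof.
move=> fr nr; apply: fr => [|r' r'v e|_ d' _]; rewrite ?/vr ?/tm; try by lia.
have er : r = r' by rewrite /vr in e; lia.
by rewrite er r'v in nr.
Qed.

Lemma frame_tm d vs m m' d0 : frame d vs m m' -> d0 < d -> m' (tm d0) = m (tm d0).
Proof. by move=> fr dd; apply: fr => *; rewrite /tm ?/vr; lia. Qed.

Lemma frame_trans d1 d2 (vs1 vs2 : seq nat) d vs m1 m2 m3 :
  frame d1 vs1 m1 m2 -> frame d2 vs2 m2 m3 ->
  d <= d1 -> d <= d2 -> {subset vs1 <= vs} -> {subset vs2 <= vs} -> frame d vs m1 m3.
Proof.
move=> f1 f2 l1 l2 s1 s2 x x1 hv ht; rewrite f2 ?f1 // => *.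
- by apply: hv; apply: s1.
- by apply: ht => //; lia.
- by apply: hv; apply: s2.
- by apply: ht => //; lia.
Qed.

Lemma frame_upd d vs m m' d' k : frame d vs m m' -> d <= d' -> tm d' < lim ->
  frame d vs m (upd m' (tm d') k).
Proof.
move=> fr dd l x x1 hv ht; rewrite /upd; case: eqP => [e|_]; last exact: fr.
by case: (ht _ d' dd) => //; rewrite e.
Qed.

Lemma frame01 d vs m m' : (forall x, 1 < x -> m' x = m x) -> frame d vs m m'.
Proof. by move=> h x x1 _ _; apply: h. Qed.

Lemma addr_ok m A d a : arrs m A ->
  let m' := effect (addr (tm d) a) m in
  m' 0 = Bs + 16 * m (tm d) + a /\ forall x, 1 < x -> m' x = m x.
Proof.
case=> m3 _ /=; rewrite /upd /=; split; first by rewrite m3; lia.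
by case=> [|[]].
Qed.

(** The second operand is computed one level deeper, so that the first value survives in [tm d]; the
    freshness conditions keep its variables intact meanwhile. *)
Lemma cexp_ok e p d m v A :
  code_at prog p (cexp p d e) -> wfe d e -> arrs m A ->
  (forall r, r \in fv e -> m (vr r) = v r) ->
  (forall b, b \in bnde e -> v b <= B) ->
  exists t m', [/\ t <= ce B e, runs prog t p m (p + size (cexp p d e)) m',
    m' (tm d) = eval v A e & frame d (bv e) m m'].
Proof.
have tm2 d' : (tm d' == 0) = false by [].
elim: e p d m v => [k|r|e1 IH1 e2 IH2|e1 IH1 e2 IH2|a e IH|i b e IH] p d m v ca wf am hv hb.
- eexists _, _; split; [|exact: runs_straight m ca isT| |]; rewrite //= ?/upd ?eqxx //.
  by apply: frame_upd.
- eexists _, _; split; [|exact: runs_straight m ca isT| |]; rewrite //=.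
    by rewrite /upd eqxx /= addn0 hv ?inE.
  by apply: frame_upd => //; apply: frame01 => -[|x].
- rewrite /= in ca wf hv hb *; case/and3P: wf => w1 w2 /allP w12.
  set c1 := cexp p d e1 in ca *; set c2 := cexp _ _ e2 in ca *.
  have [ca1 /code_at_cat[ca2 ca3]] := code_at_cat ca.
  have [||t1 [m1 [l1 r1 v1 f1]]] := IH1 p d m v ca1 w1 am.
  + by move=> r h; apply: hv; rewrite mem_cat h.
  + by move=> r h; apply: hb; rewrite mem_cat h.
  have [wl1 wl2] := wfe_lim w1; have [wl3 wl4] := wfe_lim w2.
  have am1 : arrs m1 A by apply: frame_arrs f1 am => //; rewrite /tm in wl1; lia.
  have [||t2 [m2 [l2 r2 v2 f2]]] := IH2 _ _ m1 v ca2 w2 am1.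
  + move=> r h; rewrite (frame_var f1) ?hv ?mem_cat ?h ?orbT //; exact: w12.
  + by move=> r h; apply: hb; rewrite mem_cat h orbT.
  eexists (t1 + t2 + 1), _; split; first by lia.
  + apply: runs_trans (runs_trans r1 r2) _; rewrite !size_cat !addnA.
    exact: (runs_straight m2 ca3 isT).
  + by rewrite /= /upd eqxx v2 (frame_tm f2) ?v1.
  apply: frame_upd => //; apply: frame_trans f1 f2 _ _ _ _ => // x h;
  by rewrite mem_cat h ?orbT.
- rewrite /= in ca wf hv hb *; case/and3P: wf => w1 w2 /allP w12.
  set c1 := cexp p d e1 in ca *; set c2 := cexp _ _ e2 in ca *.
  have [ca1 /code_at_cat[ca2 ca3]] := code_at_cat ca.
  have [||t1 [m1 [l1 r1 v1 f1]]] := IH1 p d m v ca1 w1 am.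
  + by move=> r h; apply: hv; rewrite mem_cat h.
  + by move=> r h; apply: hb; rewrite mem_cat h.
  have [wl1 wl2] := wfe_lim w1; have [wl3 wl4] := wfe_lim w2.
  have am1 : arrs m1 A by apply: frame_arrs f1 am => //; rewrite /tm in wl1; lia.
  have [||t2 [m2 [l2 r2 v2 f2]]] := IH2 _ _ m1 v ca2 w2 am1.
  + move=> r h; rewrite (frame_var f1) ?hv ?mem_cat ?h ?orbT //; exact: w12.
  + by move=> r h; apply: hb; rewrite mem_cat h orbT.
  eexists (t1 + t2 + 1), _; split; first by lia.
  + apply: runs_trans (runs_trans r1 r2) _; rewrite !size_cat !addnA.
    exact: (runs_straight m2 ca3 isT).
  + by rewrite /= /upd eqxx v2 (frame_tm f2) ?v1.
  apply: frame_upd => //; apply: frame_trans f1 f2 _ _ _ _ => // x h;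
  by rewrite mem_cat h ?orbT.
- case/andP: wf => a16 wf; rewrite [cexp _ _ _]/= in ca *.
  have [ca1 ca2] := code_at_cat ca.
  have [t1 [m1 [l1 r1 v1 f1]]] := IH p d m v ca1 wf am hv hb.
  have [wl1 wl2] := wfe_lim wf.
  have am1 : arrs m1 A by apply: frame_arrs f1 am => //; rewrite /tm in wl1; lia.
  have [a1 a2] := addr_ok d a am1; set m2 := effect _ _ in a1 a2.
  have r2 := runs_straight m1 ca2 isT.
  eexists _, _; split; [|rewrite size_cat addnA; exact: runs_trans r1 r2| |].
  + by rewrite /= leq_add2r.
  + rewrite -[effect _ m1]/(upd m2 (tm d) (m2 (m2 0))) /upd eqxx a1 a2; last by move: wl1; rewrite /tm; lia.
    by case: am1 => _ h; rewrite v1 h.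
  rewrite -[effect _ m1]/(upd m2 (tm d) (m2 (m2 0))); apply: frame_upd => //.
  by apply: frame_trans f1 (@frame01 d [::] _ _ a2) _ _ _ _.
move: wf => /=; case/and5P=> w1 w2 w3 w4 /and4P[w5 w6 w7 /allP w8].
rewrite [cexp _ _ _]/= in ca *.
have [i0 ca1] := code_at_cons ca.
set body := (fun q => _) in ca ca1 *.
have r0 : runs prog 1 p m p.+1 (upd m (tm d) 0) by rewrite /runs /= i0.
have [wl1 wl2] := wfe_lim w7.
have l3 : 3 < lim by rewrite /tm in w1; lia.
(* The partial sum accumulates in [tm d], the summand being computed in [tm d.+1]. *)
pose Inv k (m1 : nat -> nat) := m1 (tm d) = \sum_(0 <= j < k) eval (upd v i j) A e
   /\ frame d (i :: bv e) m m1.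
have [|||||||t [m' [t1 r1 [I1 I2] _]]] := runs_loop (Inv := Inv) (L := v b) (cost := ce B e + 1)
    (m := upd m (tm d) 0) ca1.
- by rewrite /vr; lia.
- by rewrite /vr; lia.
- by rewrite /vr; lia.
- move=> k m1 m2 [h1 h2] h; split.
    by rewrite h // /tm /vr; lia.
  have ri x : x \in [:: i] -> x \in i :: bv e by rewrite !inE => ->.
  have fi : frame d [:: i] m1 m2.
    by move=> x x1 hx _; apply: h => //; apply/eqP; apply: hx; rewrite inE.
  exact: frame_trans h2 fi _ _ _ _.
- move=> k m1 kL [h1 h2] m1i m1b.
  have hvs r : r \in i :: bv e -> vr r < lim by rewrite inE => /orP[/eqP->|/wl2].
  have am1 : arrs m1 A by apply: frame_arrs h2 am.
  have [cb1 cb2] : code_at prog (p.+1 + 3) (cexp (p.+1 + 3) d.+1 e) /\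
     code_at prog (p.+1 + 3 + size (cexp (p.+1 + 3) d.+1 e)) [:: IAdd (tm d) (tm d) (tm d.+1)].
    apply: code_at_cat; have [] := code_at_cat ca1.
    by move=> _ /code_at_cat[].
  have [||t2 [m2 [l2 r2 v2 f2]]] := IH (p.+1 + 3) d.+1 m1 (upd v i k) cb1 w7 am1.
  + move=> r rr; rewrite /upd; case: eqP => [->//|/eqP ri].
    rewrite (frame_var h2) ?inE ?negb_or ?ri ?w8 //.
    by apply: hv; rewrite /= inE mem_filter ri rr orbT.
  + move=> r rr; rewrite /upd; case: eqP => [e1|_]; first by rewrite -e1 rr in w5.
    by apply: hb; rewrite /= inE rr orbT.
  eexists (t2 + 1), _; split; first by rewrite leq_add2r.
  + rewrite size_cat addnA; apply: runs_trans r2 _.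
    exact: (runs_straight m2 cb2 isT).
  + split.
      by rewrite /= /upd eqxx v2 (frame_tm f2) // h1 big_nat_recr.
    apply: frame_upd => //; apply: frame_trans h2 f2 _ _ _ _ => // x h.
    by rewrite inE h orbT.
  have dv r : (vr r == tm d) = false by rewrite /vr /tm; lia.
  by rewrite /= /upd !dv !(frame_var f2).
- rewrite /upd (_ : (vr b == tm d) = false); last by rewrite /vr /tm; lia.
  by rewrite hv ?inE ?eqxx.
- by split; [rewrite /upd eqxx big_geq|apply: frame_upd => //; apply: frame01].
exists (1 + t), m'; split=> //.
- have h : v b * (ce B e + 1 + 5) <= B * (ce B e + 6).
    by rewrite -addnA leq_mul // hb //= inE eqxx.
  by rewrite /= (leq_add2l 1 t (3 + _)); apply: leq_trans t1 _; rewrite leq_add2l.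
- by rewrite /= -[p + _]addSnnS; apply: runs_trans r0 r1.
Qed.

(** Variables of the state lie below [pv] and those bound in expressions from [pv] on, so evaluating
    an expression leaves the state alone. *)
Fixpoint wfc c := match c with
  | Assign r e => [&& r < pv, wfe 0 e, all (fun r => r < pv) (fv e) &
                      all (fun r => pv <= r) (bv e)]
  | Store a e1 e2 => [&& a < 16, wfe 0 e1, wfe 1 e2, all (fun r => r < pv) (fv e1 ++ fv e2) &
                      all (fun r => pv <= r) (bv e1 ++ bv e2)]
  | Seq c1 c2 => wfc c1 && wfc c2
  | For i b c => [&& i < pv, b < pv, i \notin modv c, b \notin modv c, i != b & wfc c]
  end.

Definition sim m (s : state) := arrs m s.2 /\ forall r, r < pv -> m (vr r) = s.1 r.

Hypothesis pv_lim : vr pv < lim.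

Lemma ccmd_ok c p m s :
  code_at prog p (ccmd p c) -> wfc c -> sim m s ->
  (forall b, b \in bndc c -> s.1 b <= B /\ b \notin modv c) ->
  exists t m', [/\ t <= cc B c, runs prog t p m (p + size (ccmd p c)) m' & sim m' (sem c s)].
Proof.
have l3 : 3 < lim by move: pv_lim; rewrite /vr; lia.
have vrl r : r < pv -> vr r < lim by move: pv_lim; rewrite /vr; lia.
elim: c p m s => [r e|a e1 e2|c1 IH1 c2 IH2|i b c IH] p m s ca wf sm hb.
- case: sm => am vm; case/and4P: wf => rp we /allP fve /allP bve.
  have [ca1 ca2] := code_at_cat ca.
  have [||t1 [m1 [l1 r1 v1 f1]]] := cexp_ok (v := s.1) ca1 we am.
  + by move=> x /fve; apply: vm.
  + by move=> x /hb[].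
  have [_ wl2] := wfe_lim we.
  exists (t1 + 2), (effect [:: IConst 0 0; IAdd (vr r) (tm 0) 0] m1); split.
  + by rewrite leq_add2r.
  + rewrite size_cat addnA; apply: runs_trans r1 _; exact: (runs_straight m1 ca2 isT).
  have am1 := frame_arrs lim_Bs l3 wl2 f1 am.
  split.
    case: am1 => h3 ha; split=> [|x y x16]; first exact: h3.
    rewrite /effect /= /upd.
    have /vrl := rp; case: eqP => [e1|_]; first by lia.
    by rewrite ha // (_ : Bs + 16 * y + x == 0 = false) //; lia.
  move=> x xp; rewrite /effect /= /upd.
  have -> : (vr x == vr r) = (x == r) by apply/eqP/eqP; rewrite /vr; lia.
  case: eqP => [_|_] /=; first by rewrite v1 addn0.
  rewrite (frame_var f1); first exact: vm.
  by apply/negP=> /bve; rewrite leqNgt xp.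
- case: sm => am vm; case/and5P: wf => a16 w1 w2 /allP fve /allP bve.
  rewrite [ccmd _ _]/= in ca *.
  set c1 := cexp p 0 e1 in ca *; set c2 := cexp _ _ e2 in ca *.
  have [ca1 /code_at_cat[ca2 ca3]] := code_at_cat ca.
  have [||t1 [m1 [l1 r1 v1 f1]]] := cexp_ok (v := s.1) ca1 w1 am.
  + by move=> x h; apply: vm; apply: fve; rewrite mem_cat h.
  + by move=> x h; have [] // := hb x; rewrite mem_cat h.
  have [_ wl2] := wfe_lim w1; have [wl3 wl4] := wfe_lim w2.
  have am1 := frame_arrs lim_Bs l3 wl2 f1 am.
  have nb e x : {subset bv e <= bv e1 ++ bv e2} -> x < pv -> x \notin bv e.
    by move=> h xp; apply/negP=> /h /bve; rewrite leqNgt xp.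
  have nb1 x : x < pv -> x \notin bv e1 by apply: nb => y; rewrite mem_cat => ->.
  have nb2 x : x < pv -> x \notin bv e2 by apply: nb => y; rewrite mem_cat orbC => ->.
  have vm1 r : r < pv -> m1 (vr r) = s.1 r by move=> h; rewrite (frame_var f1) ?vm ?nb1.
  have [||t2 [m2 [l2 r2 v2 f2]]] := cexp_ok (v := s.1) ca2 w2 am1.
  + by move=> x h; apply: vm1; apply: fve; rewrite mem_cat h orbT.
  + by move=> x h; have [] // := hb x; rewrite mem_cat h orbT.
  have am2 := frame_arrs lim_Bs l3 wl4 f2 am1.
  have [a1 a2] := addr_ok 0 a am2; set m3 := effect _ _ in a1 a2.
  have e0 : m2 (tm 0) = eval s.1 s.2 e1 by rewrite (frame_tm f2).
  have e1' : m3 (tm 1) = eval s.1 s.2 e2 by rewrite a2.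
  exists (t1 + t2 + 8), (upd m3 (m3 0) (m3 (tm 1))); split.
  + by rewrite leq_add2r leq_add.
  + rewrite !size_cat !addnA /=; apply: runs_trans (runs_trans r1 r2) _.
    exact: (runs_straight m2 ca3 isT).
  rewrite a1 e0 e1'; split.
    case: am2 => h3 ha; split=> [|x y x16]; rewrite /= /upd.
      by rewrite (_ : 3 == _ = false) ?a2 //; lia.
    (* Both offsets are below 16, so an address determines the array and the index. *)
    have -> : (Bs + 16 * y + x == Bs + 16 * eval s.1 s.2 e1 + a) =
              (x == a) && (y == eval s.1 s.2 e1) by lia.
    by case: (eqVneq x a) => [->|xa] /=; [case: eqP => // _|]; rewrite a2 ?ha //; lia.
  move=> r rp; have rl := vrl r rp; rewrite /= /upd (_ : vr r == _ = false); last by lia.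
  by rewrite a2 // (frame_var f2) ?vm1 ?nb2.
- rewrite [ccmd _ _]/= in ca *; case/andP: wf => w1 w2.
  have [ca1 ca2] := code_at_cat ca.
  have [|t1 [m1 [l1 r1 s1]]] := IH1 _ _ s ca1 w1 sm.
    by move=> x h; have := hb x; rewrite /= !mem_cat h negb_or => /(_ isT)[? /andP[]].
  have [|t2 [m2 [l2 r2 s2]]] := IH2 _ _ _ ca2 w2 s1.
    move=> x h; have := hb x; rewrite /= !mem_cat h orbT negb_or => /(_ isT)[? /andP[]].
    by move=> h1 h2; rewrite sem_v.
  exists (t1 + t2), m2; split=> //; first by rewrite /= leq_add.
  by rewrite size_cat addnA; apply: runs_trans r1 r2.
rewrite [ccmd _ _]/= in ca *; case/and5P: wf => ip bp ni nb /andP[ib wf].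
have [bB _] : s.1 b <= B /\ b \notin modv (For i b c) by apply: hb; rewrite inE eqxx.
pose st k := iteri k (fun k s => sem c (setv i k s)) s.
(* The counter is left out: between iterations the machine has already advanced it, while [st k] has
   what the last iteration left. *)
pose Inv k (m1 : nat -> nat) := arrs m1 (st k).2 /\
  forall r, r < pv -> r != i -> m1 (vr r) = (st k).1 r.
have stv k r : r \notin modv c -> r != i -> (st k).1 r = s.1 r.
  by move=> nr ri; elim: k => //= k IHk; rewrite sem_v //= /upd (negbTE ri).
case: sm => am vm.
have [|||||||t [m' [t1 r1 [I1 I2] mi]]] := runs_loop (Inv := Inv) (L := s.1 b)
    (cost := cc B c) (m := m) ca.
- by rewrite /vr; lia.
- by rewrite /vr; lia.
- by rewrite /vr; lia.
- move=> k m1 m2 [[h1 h2] h3] h; have il := vrl i ip.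
  split; first split; rewrite ?h //.
  + by move=> x y xl; rewrite h ?h2 //; lia.
  + by move=> r rp ri; rewrite h ?h3 // /vr; lia.
- move=> k m1 kL [h1 h2] m1i m1b.
  have [|||t2 [m2 [l2 r2 [s2 s3]]]] := IH (p + 3) m1 (setv i k (st k)) _ wf.
  + by have [_ /code_at_cat[]] := code_at_cat ca.
  + split=> //= r rp; rewrite /upd; case: eqP => [->//|/eqP ri]; exact: h2.
  + move=> x xb; have [|xB] := hb x; first by rewrite inE xb orbT.
    by rewrite /= inE negb_or => /andP[xi nx]; rewrite nx /upd (negbTE xi) stv.
  exists t2, m2; split=> //; first by split=> // r rp _; apply: s3.
  split.
    by rewrite s3 // sem_v //= /upd eqxx.
  by rewrite s3 // sem_v //= /upd eq_sym (negbTE ib) stv // eq_sym.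
- exact: vm.
- by split=> // r rp _; apply: vm.
exists t, m'; split=> //.
  apply: leq_trans t1 _; rewrite /= leq_add2l leq_mul2r bB orbT //.
split=> //= r rp; rewrite /upd; case: eqP => [->|/eqP ri]; first by rewrite mi.
exact: I2.
Qed.

End Correct.

(** * Polynomial bounds on the cost *)

Lemma poly_add C1 d1 C2 d2 x y B : x <= C1 * B.+1 ^ d1 -> y <= C2 * B.+1 ^ d2 ->
  x + y <= (C1 + C2) * B.+1 ^ (d1 + d2).
Proof.
move=> h1 h2; rewrite mulnDl; apply: leq_add.
  by apply: leq_trans h1 _; rewrite leq_mul2l expnD leq_pmulr ?orbT // expn_gt0.
by apply: leq_trans h2 _; rewrite leq_mul2l expnD leq_pmull ?orbT // expn_gt0.
Qed.

(** Degrees are added rather than maximised; the exponent then counts all the sums of [e], and any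
    constant is good enough. *)
Lemma ce_poly e : exists C d, forall B, ce B e <= C * B.+1 ^ d.
Proof.
elim: e => [k|r|e1 [C1 [d1 h1]] e2 [C2 [d2 h2]]|e1 [C1 [d1 h1]] e2 [C2 [d2 h2]]|a e [C [d h]]|i b e [C [d h]]] /=.
- by exists 1, 0.
- by exists 2, 0.
- by exists (C1 + C2 + 1), (d1 + d2 + 0) => B; apply: poly_add => //; apply: poly_add.
- by exists (C1 + C2 + 1), (d1 + d2 + 0) => B; apply: poly_add => //; apply: poly_add.
- by exists (C + 8), (d + 0) => B; apply: poly_add.
exists (4 + (C + 6)), (0 + (d + 0).+1) => B; apply: poly_add => //.
by rewrite expnS mulnCA leq_mul // poly_add.
Qed.

Lemma cc_poly c : exists C d, forall B, cc B c <= C * B.+1 ^ d.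
Proof.
elim: c => [r e|a e1 e2|c1 [C1 [d1 h1]] c2 [C2 [d2 h2]]|i b c [C [d h]]] /=.
- by have [C [d h]] := ce_poly e; exists (C + 2), (d + 0) => B; apply: poly_add.
- have [C1 [d1 h1]] := ce_poly e1; have [C2 [d2 h2]] := ce_poly e2.
  by exists (C1 + C2 + 8), (d1 + d2 + 0) => B; apply: poly_add => //; apply: poly_add.
- by exists (C1 + C2), (d1 + d2) => B; apply: poly_add.
exists (3 + (C + 5)), (0 + (d + 0).+1) => B; apply: poly_add => //.
by rewrite expnS mulnCA leq_mul // poly_add.
Qed.

(** * Relocating the input *)

(* The input occupies the cells needed as registers. Doubling the first one, which
   contains the length of the input, yields the address of a free region; the
   first words are moved there one by one, and the rest by a loop. *)
Definition copy_body (_ : nat) :=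
  [:: IConst 1 7; IAdd 5 4 1; ILoad 6 5; IConst 1 16; IAdd 2 2 1; IStore 2 6].

(** Six doublings turn the input length in cell 0 into the base address, which is at least 256 as
    the input has at least 4 words. The words in cells 1 to 6, which the copying loop overwrites, go
    to entries 0 to 5 of array 0; the constant 80 is 16 times 5. *)
Definition spill1 := nseq 6 (IAdd 0 0 0) ++ [:: IStore 0 1; IConst 1 16].
Definition spill2 := flatten [seq [:: IAdd 0 0 1; IStore 0 r] | r <- iota 2 5].
Definition spill3 := [:: IConst 1 80; ISub 3 0 1; IConst 1 0; IAdd 2 0 1].
Definition spill := spill1 ++ spill2 ++ spill3.

(** The base address in cell 3 doubles as the loop bound. The excess iterations only write entries
    of array 0 beyond the input, of which [loaded] says nothing. *)
Definition prologue := spill ++ loop (size spill) 4 3 copy_body.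

Lemma effect_cat c1 c2 m : effect (c1 ++ c2) m = effect c2 (effect c1 m).
Proof. exact: foldl_cat. Qed.

Section Prologue.
Variables (prog : seq instr) (L : seq nat) (Bs : nat).
Hypotheses (L4 : 3 < size L) (BsE : Bs = 64 * size L).
Let init x := if x is x'.+1 then nth 0 L x' else size L.

Definition loaded (A : nat -> nat -> nat) :=
  (forall i, i < size L -> A 0 i = nth 0 L i) /\
  (forall a i, 0 < a < 16 -> A a i = 0).

Lemma Bs_gt : 255 < Bs. Proof. by lia. Qed.

Lemma init_big x : size L < x -> init x = 0.
Proof. by case: x => //= x h; rewrite nth_default. Qed.

Let spilled k (m : nat -> nat) :=
  [/\ m 0 = Bs + 16 * k.-1, m 1 = 16, forall j, j < k -> m (Bs + 16 * j) = init j.+1,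
      forall x, 1 < x < Bs -> m x = init x &
      forall x, Bs <= x -> (forall j, j < k -> x != Bs + 16 * j) -> m x = 0].

Lemma spilled1 : spilled 1 (effect spill1 init).
Proof.
have B6 := Bs_gt; rewrite effect_cat; set m := effect _ init.
have m0 : m 0 = Bs by rewrite /m /effect /= /upd /=; lia.
have mE x : 0 < x -> m x = init x by case: x.
rewrite /effect /= /upd /= m0; split=> //=.
- by rewrite muln0 addn0 (_ : 0 == Bs = false) //; lia.
- case=> // _; rewrite muln0 addn0 eqxx mE //=.
  by rewrite (_ : Bs == 1 = false) //; lia.
- move=> x xB; have -> : (x == 1) = false by lia.
  have -> : (x == Bs) = false by lia.
  by apply: mE; lia.
move=> x xB /(_ 0 isT) h; have -> : (x == 1) = false by lia.
have -> : (x == Bs) = false by lia.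
by rewrite mE ?init_big //; lia.
Qed.

Lemma spilledS k m : 0 < k < 6 -> spilled k m ->
  spilled k.+1 (effect [:: IAdd 0 0 1; IStore 0 k.+1] m).
Proof.
move=> k6 [m0 m1 mj mx mz]; have B6 := Bs_gt.
rewrite /effect /= /upd /= m0 m1.
have -> : Bs + 16 * k.-1 + 16 = Bs + 16 * k by lia.
split=> /=.
- by have -> : (0 == Bs + 16 * k) = false by lia.
- by have -> : (1 == Bs + 16 * k) = false by lia.
- move=> j; rewrite ltnS leq_eqVlt => /orP[/eqP->|jk].
    by rewrite eqxx mx //; lia.
  have -> : (Bs + 16 * j == Bs + 16 * k) = false by lia.
  have -> : (Bs + 16 * j == 0) = false by lia.
  exact: mj.
- move=> x xB; have -> : (x == Bs + 16 * k) = false by lia.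
  have -> : (x == 0) = false by lia.
  exact: mx.
move=> x xB h; rewrite (negbTE (h k (leqnn _))); have -> : (x == 0) = false by lia.
by apply: mz => // j jk; apply: h; lia.
Qed.

Lemma spilled_iota i k m : 0 < k -> k + i <= 6 -> spilled k m ->
  spilled (k + i) (effect (flatten [seq [:: IAdd 0 0 1; IStore 0 r] | r <- iota k.+1 i]) m).
Proof.
elim: i k m => [|i IH] k m k0 ki sk; first by rewrite addn0.
rewrite -addSnnS -[effect _ m]/(effect (flatten [seq [:: IAdd 0 0 1; IStore 0 r] | r <- iota k.+2 i])
  (effect [:: IAdd 0 0 1; IStore 0 k.+1] m)).
by apply: IH => //; [lia | apply: spilledS => //; lia].
Qed.

(** Six words were saved before the loop, whence [i + 6]. The input above cell 6 stays intact since
    copies go to addresses beyond [Bs]. *)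
Let unread i (m : nat -> nat) :=
  [/\ m 3 = Bs, m 2 = Bs + 80 + 16 * i, forall x, 6 < x < Bs -> m x = init x,
      forall j, j < i + 6 -> j < size L -> m (Bs + 16 * j) = nth 0 L j &
      forall a y, 0 < a < 16 -> m (Bs + 16 * y + a) = 0].

Lemma spill3_ok m : spilled 6 m -> unread 0 (effect spill3 m).
Proof.
have B6 := Bs_gt; move=> [m0 m1 mj mx mz].
rewrite /effect /= /upd /= m0; split=> /=.
- by lia.
- by lia.
- move=> x xB; have hi c : c < 7 -> (x == c) = false by lia.
  by rewrite !hi // mx //; lia.
- move=> j j6 _; have hi c : c < 7 -> (Bs + 16 * j == c) = false by lia.
  by rewrite !hi // mj.
move=> a y a16; have hi c : c < 7 -> (Bs + 16 * y + a == c) = false by lia.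
by rewrite !hi //; apply: mz => [|j j6]; lia.
Qed.

Lemma spill_ok : unread 0 (effect spill init).
Proof.
rewrite 2!effect_cat; apply: spill3_ok.
exact: (@spilled_iota 5 1 _ isT isT spilled1).
Qed.

Lemma copy_ok i m : unread i m -> m 4 = i ->
  unread i.+1 (effect (copy_body 0) m) /\ effect (copy_body 0) m 4 = i.
Proof.
have B6 := Bs_gt.
move=> [m3 m2 mx mj mz] m4; rewrite /effect /= /upd /= m2 m4.
have -> : Bs + 80 + 16 * i + 16 = Bs + 16 * (i + 6) by lia.
set w := if _ then _ else _.
have lo c : c < 7 -> (c == Bs + 16 * (i + 6)) = false by lia.
rewrite !lo //; split=> //; split=> /=; rewrite ?lo //.
- by lia.
- move=> x xB; have -> : (x == Bs + 16 * (i + 6)) = false by lia.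
  have hi c : c < 7 -> (x == c) = false by lia.
  by rewrite !hi // mx.
- move=> j ji jL; rewrite eqn_add2l eqn_pmul2l //.
  case: (eqVneq j (i + 6)) => [ej|nj].
    rewrite /w; have -> : i + 7 = j.+1 by lia.
    have -> : (j.+1 == 5) = false by lia.
    have -> : (j.+1 == 1) = false by lia.
    by rewrite mx //=; lia.
  have hi c : c < 7 -> (Bs + 16 * j == c) = false by lia.
  by rewrite !hi // mj //; lia.
move=> a y a16.
have hi c : c < 7 -> (Bs + 16 * y + a == c) = false by lia.
have -> : (Bs + 16 * y + a == Bs + 16 * (i + 6)) = false by lia.
by rewrite !hi // mz.
Qed.

Lemma prologue_ok : code_at prog 0 prologue ->
  exists t m A, [/\ t <= 1000 * size L, runs prog t 0 init (size prologue) m,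
    arrs Bs m A & loaded A].
Proof.
move=> ca; have [ca1 ca2] := code_at_cat ca.
have r1 := runs_straight init ca1 isT.
have [|||||||t [m [l2 r2 [m3 m2 mx mj mz] m4]]] :=
  @runs_loop prog _ 4 3 copy_body unread Bs 6 (effect spill init) ca2.
- by [].
- by [].
- by [].
- move=> i m m' [m3 m2 mx mj mz] h; have B6 := Bs_gt; split; rewrite ?h //.
  + by move=> x xB; rewrite h ?mx //; lia.
  + by move=> j ji jL; rewrite h ?mj //; lia.
  + by move=> a y a16; rewrite h ?mz //; lia.
- move=> i m iB um m4 _; have [um' m4'] := copy_ok um m4.
  exists 6, (effect (copy_body 0) m); split=> //; last by case: um'.
  have [_ /code_at_cat[ca3 _]] := code_at_cat ca2.
  exact: (runs_straight m ca3 isT).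
- by case: spill_ok.
- exact: spill_ok.
exists (size spill + t), m, (fun a i => m (Bs + 16 * i + a)); split=> //.
- have -> : size spill = 22 by [].
  by lia.
- by rewrite size_cat; apply: runs_trans r1 r2.
split=> // i iL; rewrite addn0 mj //; lia.
Qed.

End Prologue.

(** * Derived expressions and saturation *)

(* Truth is encoded as being nonzero, so that Plus and Sum act as disjunctions. *)
Definition Not e := Minus (Cst 1) e.
Definition And e1 e2 := Minus (Plus (Not (Not e1)) (Not (Not e2))) (Cst 1).
Definition Leq e1 e2 := Not (Minus e1 e2).
Definition Lt e1 e2 := Leq (Plus e1 (Cst 1)) e2.
Definition Eq e1 e2 := And (Leq e1 e2) (Leq e2 e1).
Definition All i b e := Not (Sum i b (Not e)).
(** A product as a number of pairs; the values of [b1] and [b2] must be at least the two factors. *)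
Definition Mul i1 b1 i2 b2 e1 e2 :=
  Sum i1 b1 (Sum i2 b2 (And (Lt (Var i1) e1) (Lt (Var i2) e2))).

Section Eval.
Variables (v : nat -> nat) (A : nat -> nat -> nat).
Notation ev := (eval v A).

Lemma eval_Not e : ev (Not e) = (ev e == 0).
Proof. by rewrite /=; case: (ev e). Qed.

Lemma eval_And e1 e2 : ev (And e1 e2) = (ev e1 != 0) && (ev e2 != 0).
Proof. by rewrite /=; case: (ev e1); case: (ev e2). Qed.

Lemma eval_Leq e1 e2 : ev (Leq e1 e2) = (ev e1 <= ev e2).
Proof. by rewrite eval_Not. Qed.

Lemma eval_Lt e1 e2 : ev (Lt e1 e2) = (ev e1 < ev e2).
Proof. by rewrite eval_Leq /= addn1. Qed.

Lemma eval_Eq e1 e2 : ev (Eq e1 e2) = (ev e1 == ev e2).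
Proof. by rewrite eval_And !eval_Leq !eqb0 !negbK eqn_leq. Qed.

Lemma eval_Plus0 e1 e2 : (ev (Plus e1 e2) != 0) = (ev e1 != 0) || (ev e2 != 0).
Proof. by rewrite /= addn_eq0 negb_and. Qed.

Lemma sum_neq0 b (F : nat -> nat) :
  (\sum_(0 <= k < b) F k != 0) = [exists k : 'I_b, F k != 0].
Proof. by rewrite big_mkord sum_nat_eq0 negb_forall. Qed.

Lemma eval_Sum0 i b e :
  (ev (Sum i b e) != 0) = [exists k : 'I_(v b), eval (upd v i k) A e != 0].
Proof. exact: sum_neq0. Qed.

End Eval.

Section Eval2.
Variables (v : nat -> nat) (A : nat -> nat -> nat).
Notation ev := (eval v A).

Lemma eval_All0 i b e :
  (ev (All i b e) != 0) = [forall k : 'I_(v b), eval (upd v i k) A e != 0].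
Proof.
rewrite eval_Not eqb0 eval_Sum0 negb_exists; apply: eq_forallb => k.
by rewrite eval_Not eqb0 negbK.
Qed.

Lemma sum_lt b x : x <= b -> \sum_(0 <= k < b) (k < x) = x.
Proof.
move=> xb; rewrite (big_cat_nat (leq0n x) xb) //= (eq_big_nat _ _ (F2 := fun=> 1)).
  by rewrite sum_nat_const_nat muln1 subn0 big_nat big1 ?addn0 // => i /andP[xi _]; rewrite ltnNge xi.
by move=> i /andP[_ ->].
Qed.

Lemma eval_Mul i1 b1 i2 b2 e1 e2 :
  i1 \notin fv e1 -> i1 \notin fv e2 -> i2 \notin fv e1 -> i2 \notin fv e2 ->
  i1 != i2 -> i1 != b2 -> ev e1 <= v b1 -> ev e2 <= v b2 ->
  ev (Mul i1 b1 i2 b2 e1 e2) = ev e1 * ev e2.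
Proof.
move=> h1 h2 h3 h4 h5 h6 l1 l2.
rewrite -[ev (Mul _ _ _ _ _ _)]/(\sum_(0 <= k < v b1) \sum_(0 <= j < upd v i1 k b2)
  eval (upd (upd v i1 k) i2 j) A (And (Lt (Var i1) e1) (Lt (Var i2) e2))).
rewrite -[X in _ = X * _](sum_lt l1) big_distrl; apply: eq_bigr => k _.
rewrite -[X in _ = _ * X](sum_lt l2) big_distrr.
have -> : upd v i1 k b2 = v b2 by rewrite /upd eq_sym (negbTE h6).
apply: eq_bigr => j _.
rewrite eval_And !eval_Lt !eqb0 !negbK (eval_upd _ _ _ h3) (eval_upd _ _ _ h1)
  (eval_upd _ _ _ h4) (eval_upd _ _ _ h2).
by rewrite /= /upd !eqxx (negbTE h5) mulnb.
Qed.
Lemma eval_And0 e1 e2 : (ev (And e1 e2) != 0) = (ev e1 != 0) && (ev e2 != 0).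
Proof. by rewrite eval_And eqb0 negbK. Qed.

Lemma eval_Eq0 e1 e2 : (ev (Eq e1 e2) != 0) = (ev e1 == ev e2).
Proof. by rewrite eval_Eq eqb0 negbK. Qed.

Lemma eval_Not0 e : (ev (Not e) != 0) = ~~ (ev e != 0).
Proof. by rewrite eval_Not eqb0. Qed.

Lemma exists_Sum i b e N (Q : pred 'I_N) : v b = N ->
  (forall k : 'I_N, (eval (upd v i k) A e != 0) = Q k) ->
  (ev (Sum i b e) != 0) = [exists k, Q k].
Proof. by move=> vb h; subst N; rewrite eval_Sum0; apply: eq_existsb. Qed.

Lemma forall_All i b e N (Q : pred 'I_N) : v b = N ->
  (forall k : 'I_N, (eval (upd v i k) A e != 0) = Q k) ->
  (ev (All i b e) != 0) = [forall k, Q k].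
Proof. by move=> vb h; subst N; rewrite eval_All0; apply: eq_forallb. Qed.

End Eval2.

Definition eval_bool := (eval_Eq0, eval_And0, eval_Plus0, eval_Not0).

Lemma for_ind (I : nat -> state -> Prop) i b c s :
  (forall k s, I k s -> forall x, I k (setv i x s)) ->
  (forall k s', k < s.1 b -> I k s' -> I k.+1 (sem c (setv i k s'))) ->
  I 0 s -> I (s.1 b) (sem (For i b c) s).
Proof.
move=> st h I0; apply: st; move: (s.1 b) h => L h.
suff : forall k, k <= L -> I k (iteri k (fun k s => sem c (setv i k s)) s) by apply.
by elim=> //= k IH kL; apply: h => //; apply: IH; apply: ltnW.
Qed.

(** * Reachability by saturation of marks *)

Section Closure.
Variables (r y b a : nat) (base cond : expr).
(** Each round marks, in place, every node with a marked predecessor; adding [cond] to the old entry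
    never erases a mark. *)
Definition saturate :=
  For r b (For y b (Store a (Plus base (Var y)) (Plus (Get a (Plus base (Var y))) cond))).

Variables (s : state) (V be : nat) (T : rel 'I_V).
Hypotheses (bV : s.1 b = V) (ry : r != y) (br : b != r) (bey : b != y).

Definition kept (s' : state) :=
  [/\ forall x, x != r -> x != y -> s'.1 x = s.1 x,
      forall a', a' != a -> s'.2 a' = s.2 a' &
      forall i, ~~ (be <= i < be + V) -> s'.2 a i = s.2 a i].

Definition mark (s' : state) (z : 'I_V) := s'.2 a (be + z) != 0.

Hypothesis base_ok : forall s', kept s' -> eval s'.1 s'.2 base = be.
Hypothesis cond_ok : forall s' (z : 'I_V), kept s' -> s'.1 y = z ->
  (eval s'.1 s'.2 cond != 0) = [exists x : 'I_V, mark s' x && T x z].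

Lemma kept_setv s' x k : (x == r) || (x == y) -> kept s' -> kept (setv x k s').
Proof.
by move=> xry [h1 h2 h3]; split=> //= z zr zy; rewrite /upd; case: eqP => [e|_];
  [move: xry; rewrite -e (negbTE zr) (negbTE zy)|exact: h1].
Qed.

Definition sound (s' : state) :=
  kept s' /\ forall z, mark s' z -> [exists x, mark s x && connect T x z].

(** As marks made during a round may be used at once, progress is measured against the marks of
    [s0], the state at the start of the round. *)
Definition stepped (s0 s' : state) k :=
  [/\ sound s', forall z, mark s0 z -> mark s' z &
      forall x z : 'I_V, z < k -> mark s0 x -> T x z -> mark s' z].

Let body := Store a (Plus base (Var y)) (Plus (Get a (Plus base (Var y))) cond).

Lemma saturate_body s0 s' k : k < V -> stepped s0 s' k ->
  stepped s0 (sem body (setv y k s')) k.+1.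
Proof.
move=> kV [[ks so] mono pr].
have k1 : kept (setv y k s') by apply: kept_setv; rewrite // eqxx orbT.
have ey : (setv y k s').1 y = k by rewrite /= /upd eqxx.
have m1 z : mark s' z = mark (setv y k s') z by [].
move: (setv y k s') k1 ey m1 => s1 k1 ey m1.
have mk z : mark (sem body s1) z = mark s' z || ((z == Ordinal kV) && [exists x, mark s' x && T x (Ordinal kV)]).
  rewrite {1}/mark /= base_ok // ey eqxx /upd eqn_add2l m1.
  case: (eqVneq z (Ordinal kV)) => [->|nz]; last first.
    have -> : (nat_of_ord z == k) = false by apply: negbTE.
    by rewrite orbF -m1.
  rewrite /= eqxx addn_eq0 negb_and (cond_ok (z := Ordinal kV)) //; congr (_ || _).
  by apply: eq_existsb => x; rewrite m1.
have k2 : kept (sem body s1).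
  have [h1 h2 h3] := k1; split=> //= [a' aa|i iV]; first by rewrite (negbTE aa) h2.
  rewrite eqxx /upd base_ok // ey; case: eqP => [e|_]; last exact: h3.
  by case/negP: iV; rewrite e leq_addr ltn_add2l.
split; first split=> // z; rewrite ?mk.
- case/orP=> [/so //|/andP[/eqP-> /existsP[x /andP[/so /existsP[x0 /andP[h1 h2]] Tx]]]].
  by apply/existsP; exists x0; rewrite h1; apply: connect_trans h2 (connect1 Tx).
- by move=> z /mono h; rewrite mk h.
move=> x z; rewrite ltnS leq_eqVlt mk => /orP[/eqP zk|zk] mx Tx; last by rewrite (pr x z).
have ez : z = Ordinal kV by apply: val_inj.
by apply/orP; right; rewrite ez eqxx; apply/existsP; exists x; rewrite mono // -ez.
Qed.

Definition reached (s' : state) k := sound s' /\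
  forall x p, mark s x -> path T x p -> size p <= k -> mark s' (last x p).

Lemma saturate_round s' k : reached s' k -> reached (sem (For y b body) (setv r k s')) k.+1.
Proof.
move=> [[ks so] re]; set s0 := setv r k s'.
have ks0 : kept s0 by apply: kept_setv; rewrite // eqxx.
have bs0 : s0.1 b = V by case: ks0 => -> //.
have [|||so' mono pr] := @for_ind (fun k s' => stepped s0 s' k) y b body s0.
- move=> j s1 [[k1 so1] h2 h3] x; split=> //; split=> //.
  by apply: kept_setv; rewrite // eqxx orbT.
- by rewrite bs0 => j s1 jV; apply: saturate_body.
- by split.
split=> // x p; case: (lastP p) => [|q z] mx.
  by move=> _ _; apply: mono; exact: (re x [::]).
rewrite rcons_path last_rcons size_rcons ltnS => /andP[pq Tz] sq.
by apply: pr Tz; rewrite ?bs0 //; exact: (re x q).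
Qed.

(** After [k] rounds all paths of length at most [k] are accounted for, and a path without
    repetition has fewer than [V] steps. *)
Lemma saturate_ok : kept (sem saturate s) /\
  forall z, mark (sem saturate s) z = [exists x, mark s x && connect T x z].
Proof.
have k0 : kept s by [].
have [|||[ks so] re] := @for_ind (fun k s' => reached s' k) r b (For y b body) s.
- move=> j s1 [[k1 so1] h2] x; split=> //; split=> //.
  by apply: kept_setv; rewrite // eqxx.
- by move=> j s1 _; apply: saturate_round.
- split; first split=> // z mz.
    by apply/existsP; exists z; rewrite mz connect0.
  by move=> x [|y' p] //.
split=> // z; apply/idP/idP; first exact: so.
case/existsP=> x /andP[mx /connectP[p /shortenP[q pq uq _] ->]].
apply: re => //; rewrite bV.
have := card_uniqP uq; have := max_card (mem (x :: q)); rewrite card_ord /= => h1 h2.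
by rewrite ltnW // -h2.
Qed.

End Closure.

(** * The program *)

(* Variables. v_arcs1 is one more than the number of arcs of M, v_codes is
   n ^ k, the number of positions of the game (written in base n), v_base the
   address of a row of the reachability table and v_pairs that of the list of
   pairs. Variables from 24 on only occur bound in expressions.

   Arrays: 0 is the input, 1 and 2 hold the tails and the heads of the arcs of M
   (forward edges, backward edges, arcs of G), 3 the reachability table of M
   without the arc a, for each a (nothing is removed if a is the number of
   arcs), 4 the positions reached so far and 5 the powers of n. *)
Local Notation v_n := 0 (only parsing).
Local Notation v_m := 1 (only parsing).
Local Notation v_l := 2 (only parsing).
Local Notation v_k := 3 (only parsing).
Local Notation v_arcs := 4 (only parsing).
Local Notation v_arcs1 := 5 (only parsing).
Local Notation v_nn := 6 (only parsing).
Local Notation v_codes := 7 (only parsing).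
Local Notation v_base := 8 (only parsing).
Local Notation v_pairs := 9 (only parsing).
Local Notation v_i := 10 (only parsing).
Local Notation v_cut := 11 (only parsing).
Local Notation v_x := 12 (only parsing).
Local Notation v_round := 13 (only parsing).
Local Notation v_y := 14 (only parsing).
Local Notation v_out := 15 (only parsing).

Definition ereach a x y :=
  Get 3 (Plus (Mul 36 v_arcs1 37 v_nn a (Var v_nn)) (Plus (Mul 38 v_n 39 v_n x (Var v_n)) y)).

(** The quotient is the number of [i] with [i * p + p <= x]. *)
Definition ediv x p := Sum 26 v_codes (Leq (Plus (Mul 24 v_codes 25 v_codes (Var 26) p) p) x).

(** Digit [j] is the quotient by [n ^ j] minus [n] times the quotient by [n ^ j.+1]; the sum of [n]
    equal terms is that product. *)
Definition edig x j :=
  Minus (ediv x (Get 5 j)) (Sum 28 v_n (ediv x (Get 5 (Plus j (Cst 1))))).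

Definition esrc j := Get 0 (Plus (Var v_pairs) (Plus j j)).
Definition etgt j := Get 0 (Plus (Plus (Var v_pairs) (Plus j j)) (Cst 1)).

Definition earc y z := Sum 31 v_arcs (And (Eq (Get 1 (Var 31)) y) (Eq (Get 2 (Var 31)) z)).

Definition eok w x y z t :=
  let R := ereach (Var v_arcs) in
  Plus (And (And (Eq x y) (Eq y z)) (Plus (Eq x t) (Not (R x w))))
       (And (R x w) (And (R w x) (And (R y w) (And (R w y)
         (Plus (And (Eq z y) (Eq y t)) (And (earc y z) (Not (R z w)))))))).

Definition eneed a x y := Sum 30 v_k (Not (ereach a (edig x (Var 30)) (edig y (Var 30)))).

(** The two directions of edge [e] are the arcs number [e] and [m + e] of M. *)
Definition enoconf x y :=
  Not (Sum 32 v_m (And (eneed (Var 32) x y) (eneed (Plus (Var v_m) (Var 32)) x y))).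

Definition estep x z :=
  Sum 33 v_n (Sum 34 v_codes (And
    (All 30 v_k (eok (Var 33) (edig x (Var 30)) (edig (Var 34) (Var 30))
                    (edig z (Var 30)) (etgt (Var 30))))
    (enoconf x (Var 34)))).

(** The input reads n, m, 2m edge ends, l, 2l arc ends, k, 2k pair ends; this gives the offsets. *)
Definition c_header :=
  Seq (Assign v_n (Get 0 (Cst 0)))
 (Seq (Assign v_m (Get 0 (Cst 1)))
 (Seq (Assign v_l (Get 0 (Plus (Cst 2) (Plus (Var v_m) (Var v_m)))))
 (Seq (Assign v_pairs (Plus (Plus (Cst 4) (Plus (Var v_m) (Var v_m))) (Plus (Var v_l) (Var v_l))))
 (Seq (Assign v_k (Get 0 (Minus (Var v_pairs) (Cst 1))))
 (Seq (Assign v_arcs (Plus (Plus (Var v_m) (Var v_m)) (Var v_l)))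
      (Assign v_arcs1 (Plus (Var v_arcs) (Cst 1)))))))).

Definition ein c := Get 0 (Plus c (Plus (Var v_i) (Var v_i))).

Definition c_edges :=
  For v_i v_m (Seq (Store 1 (Var v_i) (ein (Cst 2)))
            (Seq (Store 2 (Var v_i) (ein (Cst 3)))
            (Seq (Store 1 (Plus (Var v_m) (Var v_i)) (ein (Cst 3)))
                 (Store 2 (Plus (Var v_m) (Var v_i)) (ein (Cst 2)))))).

Definition c_arcs :=
  let m2 := Plus (Var v_m) (Var v_m) in
  For v_i v_l (Seq (Store 1 (Plus m2 (Var v_i)) (ein (Plus m2 (Cst 3))))
                 (Store 2 (Plus m2 (Var v_i)) (ein (Plus m2 (Cst 4))))).

Definition c_pow :=
  Seq (Assign v_nn (Sum 24 v_n (Var v_n)))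
 (Seq (Assign v_codes (Cst 1))
 (Seq (For v_i v_k (Seq (Store 5 (Var v_i) (Var v_codes)) (Assign v_codes (Sum 24 v_n (Var v_codes)))))
      (Store 5 (Var v_k) (Var v_codes)))).

Definition c_tables := Seq c_edges (Seq c_arcs c_pow).

Definition ereachable :=
  Sum 31 v_arcs (And (Eq (Get 2 (Var 31)) (Var v_y))
    (And (Not (Eq (Var 31) (Var v_cut))) (Get 3 (Plus (Var v_base) (Get 1 (Var 31)))))).

Definition c_reach_row :=
  Seq (Store 3 (Plus (Var v_base) (Var v_x)) (Cst 1))
 (Seq (saturate v_round v_y v_n 3 (Var v_base) ereachable)
      (Assign v_base (Plus (Var v_base) (Var v_n)))).

Definition c_reach := Seq (Assign v_base (Cst 0)) (For v_cut v_arcs1 (For v_x v_n c_reach_row)).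

Definition eall x f := All 30 v_k (Eq (edig x (Var 30)) (f (Var 30))).

Definition c_game :=
  Seq (For v_x v_codes (Store 4 (Var v_x) (eall (Var v_x) esrc)))
 (Seq (saturate v_round v_y v_codes 4 (Cst 0) (Sum 35 v_codes (And (Get 4 (Var 35)) (estep (Var 35) (Var v_y)))))
      (Assign v_out (Not (Not (Sum 35 v_codes (And (Get 4 (Var 35)) (eall (Var 35) etgt))))))).

Definition c_search := Seq c_reach c_game.

Lemma wf_header : wfc 256 24 c_header. Proof. by vm_compute. Qed.
Lemma wf_tables : wfc 256 24 c_tables. Proof. by vm_compute. Qed.
Lemma wf_search : wfc 256 24 c_search. Proof. by vm_compute. Qed.

(** The program has three phases because a loop bound must not be modified within its phase: the
    header computes the bounds of the tables phase, and both supply those of the search. *)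
Lemma bnd_tables : all (fun b => (b \in [:: v_n; v_m; v_l; v_k]) && (b \notin modv c_tables)) (bndc c_tables).
Proof. by vm_compute. Qed.

Lemma bnd_search : all (fun b => (b \in [:: v_n; v_m; v_k; v_arcs; v_arcs1; v_nn; v_codes]) &&
  (b \notin modv c_search)) (bndc c_search).
Proof. by vm_compute. Qed.

(** * Evaluation of the expressions of the program *)

Lemma eval_ediv v A x p : 26 \notin fv x -> all (fun r => r \notin fv p) [:: 24; 25; 26] ->
  eval v A x < v v_codes -> 0 < eval v A p <= v v_codes ->
  eval v A (ediv x p) = eval v A x %/ eval v A p.
Proof.
move=> fx /and4P[p24 p25 p26 _] xN /andP[p0 pN].
rewrite -[eval v A (ediv x p)]/(\sum_(0 <= i < v v_codes)
  eval (upd v 26 i) A (Leq (Plus (Mul 24 v_codes 25 v_codes (Var 26) p) p) x)).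
rewrite -[RHS](@sum_lt (v v_codes)); last by apply: leq_trans (leq_div _ _) (ltnW xN).
apply: eq_big_nat => i /andP[_ iN].
rewrite eval_Leq -[eval _ _ (Plus _ _)]/(eval (upd v 26 i) A (Mul 24 v_codes 25 v_codes (Var 26) p) +
   eval (upd v 26 i) A p).
rewrite eval_Mul ?(eval_upd _ _ _ p26) ?(eval_upd _ _ _ fx) //; last exact: ltnW.
by rewrite /= /upd eqxx -mulSnr -leq_divRL.
Qed.

Section Inst.
Variables (n : nat) (G : mixed_graph n) (P : {set 'I_n * 'I_n}).
Notation m := (size (medges G)).
Notation l := (size (marcs G)).
Notation k := (size (enum P)).
Notation T := (m + m + l).
Let pair (j : 'I_k) := tnth (in_tuple (enum P)) j.

Definition env v :=
  [/\ v v_n = n, v v_m = m, v v_l = l, v v_k = k &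
   [/\ v v_arcs = T, v v_arcs1 = T.+1, v v_nn = n * n, v v_codes = n ^ k & v v_pairs = 4 + (m + m) + (l + l)]].

Lemma env_ext v v' : (forall c, c < 10 -> c != v_base -> v' c = v c) -> env v -> env v'.
Proof. by move=> h [? ? ? ? [? ? ? ? ?]]; split; rewrite ?h //; split; rewrite ?h. Qed.

Lemma env_upd v i x : 9 < i -> env v -> env (upd v i x).
Proof.
move=> i9; apply: env_ext => c c10 _; rewrite /upd; case: eqP => // e.
by rewrite e ltnNge i9 in c10.
Qed.

Definition arc_index (p : 'I_m * bool) : nat := if p.2 then nat_of_ord p.1 else m + p.1.

Definition arc_tables (src dst : nat -> nat) :=
  (forall p, src (arc_index p) = (dir p).1 /\ dst (arc_index p) = (dir p).2) /\
  (forall h : 'I_l, src (m + m + h) = (tnth (in_tuple (marcs G)) h).1 /\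
                    dst (m + m + h) = (tnth (in_tuple (marcs G)) h).2).

Definition keep (a : nat) : {set 'I_m * bool} := [set p | arc_index p != a].

Lemma arc_index_inj : injective arc_index.
Proof.
move=> [e1 []] [e2 []]; rewrite /arc_index /= => h; congr (_, _);
  try (apply: val_inj => /=); move: (ltn_ord e1) (ltn_ord e2); lia.
Qed.

Lemma arc_index_lt p : arc_index p < m + m.
Proof. by case: p => e []; rewrite /arc_index /=; move: (ltn_ord e); lia. Qed.

Lemma keep_index p : keep (arc_index p) = setT :\ p.
Proof. by apply/setP=> q; rewrite !inE andbT (inj_eq arc_index_inj). Qed.

Lemma keep_T : keep T = setT.
Proof. by apply/setP=> q; rewrite !inE; have := arc_index_lt q; lia. Qed.

Definition arc_rel (src dst : nat -> nat) a : rel 'I_n :=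
  fun x y => [exists h : 'I_T, (dst h == y) && ((h != a :> nat) && (src h == x))].

(** The hypothesis on [a] makes the removed index a direction of an edge or nothing at all, so that
    all arcs of [G] remain. *)
Lemma arc_relE src dst a x y : arc_tables src dst -> a < m + m \/ a = T ->
  arc_rel src dst a x y = gr (keep a) x y.
Proof.
move=> [tE tA] aT; apply/existsP/orP.
- case=> h /and3P[/eqP dy ha /eqP sx].
  have eqxy (u w : 'I_n) : src h = u -> dst h = w -> (u, w) = (x, y).
    by rewrite sx dy => e1 e2; congr (_, _); apply: val_inj.
  have idx p : h = arc_index p :> nat -> exists p0, (p0 \in keep a) && (dir p0 == (x, y)).
    move=> hp; have [e1 e2] := tE p; exists p; rewrite inE -hp ha /=.
    by rewrite [dir p]surjective_pairing (eqxy (dir p).1 (dir p).2) // hp.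
  case: (ltnP h m) => [hm|mh].
    by right; apply/existsP; apply: (idx (Ordinal hm, true)).
  case: (ltnP h (m + m)) => [hm|mmh].
    have hm' : h - m < m by lia.
    by right; apply/existsP; apply: (idx (Ordinal hm', false)); rewrite /arc_index /=; lia.
  left; have hl : h - (m + m) < l by move: (ltn_ord h); lia.
  have [] := tA (Ordinal hl); rewrite /= subnKC // => e1 e2.
  have <- := eqxy _ _ e1 e2; rewrite -surjective_pairing; exact: mem_tnth.
case=> [/(tnthP (in_tuple (marcs G)))[h e]|/existsP[p /andP[pa /eqP dp]]].
  have hT : m + m + h < T by rewrite ltn_add2l.
  exists (Ordinal hT); have [/= -> ->] := tA h; rewrite -e !eqxx andbT /=.
  by case: aT => [|->]; move: (ltn_ord h); lia.
have hT : arc_index p < T by have := arc_index_lt p; lia.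
exists (Ordinal hT); have [/= -> ->] := tE p; rewrite dp !eqxx andbT /=.
by move: pa; rewrite inE.
Qed.

(** * Meaning of the expressions once the tables are correct *)

Section Tables.
Variable A : nat -> nat -> nat.
Hypotheses (tab12 : arc_tables (A 1) (A 2)) (tab5 : forall i, i <= k -> A 5 i = n ^ i).
Hypothesis pairs_in : forall j : 'I_k,
  A 0 (4 + (m + m) + (l + l) + (j + j)) = (pair j).1 /\
  A 0 (4 + (m + m) + (l + l) + (j + j) + 1) = (pair j).2.

Lemma eval_edig v x j : env v -> 0 < n ->
  all (fun r => r \notin fv x) [:: 26; 28] ->
  all (fun r => r \notin fv j) [:: 24; 25; 26; 28] ->
  eval v A x < n ^ k -> eval v A j < k ->
  eval v A (edig x j) = eval v A x %/ n ^ eval v A j %% n.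
Proof.
move=> ev n0 /and3P[x26 x28 _] /and5P[j24 j25 j26 j28 _] xN jk.
have [en _ _ _ [_ _ _ eN _]] := ev.
have pw i : i <= k -> 0 < n ^ i <= n ^ k by move=> ik; rewrite expn_gt0 n0 leq_pexp2l.
have e1 : eval v A (ediv x (Get 5 j)) = eval v A x %/ n ^ eval v A j.
  by rewrite eval_ediv ?eN //= ?j24 ?j25 ?j26 //= tab5 ?pw // ltnW.
rewrite -[eval v A (edig x j)]/(eval v A (ediv x (Get 5 j)) - \sum_(0 <= i < v v_n)
   eval (upd v 28 i) A (ediv x (Get 5 (Plus j (Cst 1))))).
rewrite e1 (eq_big_nat _ _ (F2 := fun=> eval v A x %/ n ^ (eval v A j).+1)).
  rewrite sum_nat_const_nat subn0 en expnSr divnMA.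
  by set X := _ %/ n ^ _; rewrite {1}(divn_eq X n) mulnC addKn.
move=> i _; rewrite eval_ediv //= ?eval_upd // ?cats0 ?mem_cat ?orbF ?j24 ?j25 ?j26 //.
- by rewrite addn1 tab5.
- by rewrite /upd /= eN.
- by rewrite addn1 tab5 // /upd /= eN pw.
Qed.

Lemma eval_ereach v a x y : env v ->
  all (fun r => r \notin fv a) [:: 36; 37] -> all (fun r => r \notin fv x) [:: 38; 39] ->
  eval v A a <= T -> eval v A x <= n ->
  eval v A (ereach a x y) = A 3 ((eval v A a * n + eval v A x) * n + eval v A y).
Proof.
move=> ev /and3P[a1 a2 _] /and3P[x1 x2 _] aT xn.
have [en _ _ _ [_ eT1 en2 _ _]] := ev.
rewrite -[eval v A _]/(A 3 (eval v A (Mul 36 v_arcs1 37 v_nn a (Var v_nn)) +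
  (eval v A (Mul 38 v_n 39 v_n x (Var v_n)) + eval v A y))).
rewrite !eval_Mul //=; rewrite ?en ?eT1 ?en2 //; last exact: leqW.
by rewrite mulnDl -mulnA addnA.
Qed.

Hypothesis tab3 : forall a (x y : 'I_n), a < m + m \/ a = T ->
  (A 3 ((a * n + x) * n + y) != 0) = rch (keep a) x y.

Lemma ereach_ok v a x y a0 (x0 y0 : 'I_n) : env v ->
  all (fun r => r \notin fv a) [:: 36; 37] -> all (fun r => r \notin fv x) [:: 38; 39] ->
  a0 < m + m \/ a0 = T -> eval v A a = a0 -> eval v A x = x0 -> eval v A y = y0 ->
  (eval v A (ereach a x y) != 0) = rch (keep a0) x0 y0.
Proof.
move=> ev fa fx aT ea ex ey; rewrite eval_ereach ?ea ?ex ?ey ?tab3 //; last exact: ltnW.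
by case: aT; lia.
Qed.

Lemma earc_ok v y z (y0 z0 : 'I_n) : env v -> 31 \notin fv y -> 31 \notin fv z ->
  eval v A y = y0 -> eval v A z = z0 ->
  (eval v A (earc y z) != 0) = gr (G := G) setT y0 z0.
Proof.
move=> ev fy fz ey ez; have [_ _ _ _ [eT _ _ _ _]] := ev.
rewrite -keep_T -(arc_relE _ _ tab12 (or_intror erefl)).
apply: exists_Sum eT _ => h.
rewrite !eval_bool (eval_upd _ _ _ fy) (eval_upd _ _ _ fz) ey ez /= /upd eqxx.
by rewrite (ltn_eqF (ltn_ord h)) andbC.
Qed.

Lemma eok_ok v w x y z t (w0 x0 y0 z0 t0 : 'I_n) : env v ->
  all (fun e => all (fun r => r \notin fv e) [:: 31; 38; 39]) [:: w; x; y; z; t] ->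
  eval v A w = w0 -> eval v A x = x0 -> eval v A y = y0 -> eval v A z = z0 -> eval v A t = t0 ->
  (eval v A (eok w x y z t) != 0) = okmove G w0 x0 y0 z0 t0.
Proof.
move=> ev /and5P[] /and4P[w31 w38 w39 _] /and4P[x31 x38 x39 _] /and4P[y31 y38 y39 _].
move=> /and4P[z31 z38 z39 _] _ ew ex ey ez et.
have [_ _ _ _ [eT _ _ _ _]] := ev.
have R a b (a0 b0 : 'I_n) : 38 \notin fv a -> 39 \notin fv a -> eval v A a = a0 ->
    eval v A b = b0 -> (eval v A (ereach (Var v_arcs) a b) != 0) = rch (G := G) setT a0 b0.
  move=> a38 a39 ea eb; rewrite -keep_T; apply: ereach_ok => //=; first by rewrite a38 a39.
  by right.
rewrite /eok !eval_bool (R x w x0 w0) // (R w x w0 x0) // (R y w y0 w0) // (R w y w0 y0) //.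
by rewrite (R z w z0 w0) // (earc_ok (y0 := y0) (z0 := z0)) // ex ey ez et.
Qed.

Lemma n_gt0 (j : 'I_k) : 0 < n.
Proof. by apply: leq_ltn_trans (leq0n _) (ltn_ord (pair j).1). Qed.

(** Positivity of [n] is drawn from the index [j]; without pairs there are no digits and [n ^ 0]
    leaves a single position. *)
Definition digit (x : nat) (j : 'I_k) : 'I_n := Ordinal (ltn_pmod (x %/ n ^ j) (n_gt0 j)).

Lemma edig_ok v c (j : 'I_k) : env v -> c \notin [:: 26; 28] -> v c < n ^ k -> v 30 = j ->
  eval v A (edig (Var c) (Var 30)) = digit (v c) j.
Proof.
rewrite !inE negb_or => ev /andP[c26 c28] vc vj.
have [_ _ _ _ [_ _ _ eN _]] := ev.
rewrite eval_edig //= ?vj // ?(n_gt0 j) ?inE //.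
by rewrite (eq_sym 26) (eq_sym 28) c26 c28.
Qed.

Lemma eneed_ok v a p : env v -> all (fun r => r \notin fv a) [:: 30; 36; 37] ->
  eval v A a = arc_index p -> v 35 < n ^ k -> v 34 < n ^ k ->
  (eval v A (eneed a (Var 35) (Var 34)) != 0) =
  [exists j : 'I_k, need p (digit (v 35) j) (digit (v 34) j)].
Proof.
move=> ev /and4P[a30 a36 a37 _] ea x35 x34; have [_ _ _ ek _] := ev.
apply: exists_Sum ek _ => j; rewrite eval_Not0 /need; congr (~~ _).
have ev' : env (upd v 30 j) by apply: env_upd.
rewrite -keep_index; apply: ereach_ok => //=.
- by rewrite a36 a37.
- by left; apply: arc_index_lt.
- by rewrite eval_upd.
- exact: (@edig_ok (upd v 30 j) 35).
- exact: (@edig_ok (upd v 30 j) 34).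
Qed.

Lemma enoconf_ok v : env v -> v 35 < n ^ k -> v 34 < n ^ k ->
  (eval v A (enoconf (Var 35) (Var 34)) != 0) = noconf G (digit (v 35)) (digit (v 34)).
Proof.
move=> ev x35 x34; have [_ em _ _ _] := ev.
rewrite eval_Not0 /noconf -negb_exists; congr (~~ _).
apply: exists_Sum em _ => e; have ev' : env (upd v 32 e) by apply: env_upd.
rewrite eval_And0 (@eneed_ok _ _ (e, true)) // (@eneed_ok _ _ (e, false)) //.
by case: ev => _ em _ _ _; rewrite /= /upd /= em.
Qed.

Definition tgt (j : 'I_k) := (pair j).2.
Definition srcs (j : 'I_k) := (pair j).1.

Lemma etgt_ok v (j : 'I_k) : env v -> v 30 = j -> eval v A (etgt (Var 30)) = tgt j.
Proof.
move=> [_ _ _ _ [_ _ _ _ eP]] vj; rewrite /= eP vj.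
by case: (pairs_in j) => _; rewrite addnA.
Qed.

Lemma esrc_ok v (j : 'I_k) : env v -> v 30 = j -> eval v A (esrc (Var 30)) = srcs j.
Proof. by move=> [_ _ _ _ [_ _ _ _ eP]] vj; rewrite /= eP vj; case: (pairs_in j). Qed.

Lemma estep_ok v (x z : 'I_(n ^ k)) : env v -> v 35 = x -> v v_y = z ->
  (eval v A (estep (Var 35) (Var v_y)) != 0) =
  gstep G (fun x : 'I_(n ^ k) => digit x) tgt x z.
Proof.
move=> ev vx vz; have [en _ _ ek [_ _ _ eN _]] := ev.
apply: exists_Sum en _ => w; apply: exists_Sum (_ : upd v 33 w v_codes = n ^ k) _ => // y.
set v' := upd (upd v 33 w) 34 y.
have ev' : env v' by do 2! apply: env_upd => //.
rewrite eval_And0 enoconf_ok //; [|by rewrite /v' /upd /= vx|by rewrite /v' /upd /=].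
have -> : v' 35 = x by []. have -> : v' 34 = y by [].
have Q : (eval v' A (All 30 v_k (eok (Var 33) (edig (Var 35) (Var 30)) (edig (Var 34) (Var 30))
                    (edig (Var v_y) (Var 30)) (etgt (Var 30)))) != 0) =
  [forall j, okmove G w (digit x j) (digit y j) (digit z j) (tgt j)].
  apply: forall_All => [|j]; first by case: ev'.
  have ev2 : env (upd v' 30 j) by apply: env_upd.
  apply: eok_ok => //.
  - have e : upd v' 30 j 35 = x by exact: vx.
    by rewrite (@edig_ok (upd v' 30 j) 35 j) ?e.
  - have e : upd v' 30 j 34 = y by [].
    by rewrite (@edig_ok (upd v' 30 j) 34 j) ?e.
  - have e : upd v' 30 j v_y = z by exact: vz.
    by rewrite (@edig_ok (upd v' 30 j) v_y j) ?e.
  - exact: etgt_ok.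
by rewrite Q.
Qed.

End Tables.
End Inst.

(** * Layout of the input *)

Section Input.
Variable n : nat.
Let flat (s : seq ('I_n * 'I_n)) := flatten [seq [:: val e.1; val e.2] | e <- s].

Lemma size_flat s : size (flat s) = size s + size s.
Proof. by elim: s => //= e s; rewrite /flat /= => ->; lia. Qed.

Lemma nth_flat (s : seq ('I_n * 'I_n)) (i : 'I_(size s)) :
  nth 0 (flat s) (i + i) = (tnth (in_tuple s) i).1 /\
  nth 0 (flat s) (i + i + 1) = (tnth (in_tuple s) i).2.
Proof.
have x0 := tnth (in_tuple s) i; rewrite (tnth_nth x0) /=.
elim: s i => [|e s IH] [[|i] ilt] //=.
by rewrite addnS; exact: (IH (Ordinal (ilt : i < size s))).
Qed.

Variables (G : mixed_graph n) (P : {set 'I_n * 'I_n}).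
Notation m := (size (medges G)).
Notation l := (size (marcs G)).
Notation k := (size (enum P)).

Lemma encodeE : encode G P =
  [:: n; m] ++ flat (medges G) ++ [:: l] ++ flat (marcs G) ++ [:: k] ++ flat (enum P).
Proof. by []. Qed.

Lemma size_encode : size (encode G P) = 4 + (m + m) + (l + l) + (k + k).
Proof. by rewrite encodeE !size_cat !size_flat /=; lia. Qed.

Variable A : nat -> nat -> nat.
Hypothesis ld : loaded (encode G P) A.

Lemma input_at i : i < 4 + (m + m) + (l + l) + (k + k) -> A 0 i = nth 0 (encode G P) i.
Proof. by case: ld => h _ il; rewrite h ?size_encode. Qed.

Lemma input_n : A 0 0 = n. Proof. by rewrite input_at. Qed.
Lemma input_m : A 0 1 = m. Proof. by rewrite input_at. Qed.

Lemma input_edge (e : 'I_m) : A 0 (2 + (e + e)) = (tnth (in_tuple (medges G)) e).1 /\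
  A 0 (3 + (e + e)) = (tnth (in_tuple (medges G)) e).2.
Proof.
have le := ltn_ord e; case: (nth_flat e) => <- <-.
rewrite !input_at; try lia.
rewrite !encodeE !nth_cat !size_flat /= !addKn.
by rewrite !ifT ?addn1 //; lia.
Qed.

Lemma input_l : A 0 (2 + (m + m)) = l.
Proof. by rewrite input_at ?encodeE ?nth_cat ?size_flat /= ?addKn ?ltnn ?subnn //; lia. Qed.

Lemma nth_skip (s1 s2 : seq nat) i : size s1 <= i -> nth 0 (s1 ++ s2) i = nth 0 s2 (i - size s1).
Proof. by move=> h; rewrite nth_cat ltnNge h. Qed.

Lemma input_arc (e : 'I_l) : A 0 (3 + (m + m) + (e + e)) = (tnth (in_tuple (marcs G)) e).1 /\
  A 0 (4 + (m + m) + (e + e)) = (tnth (in_tuple (marcs G)) e).2.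
Proof.
have le := ltn_ord e; case: (nth_flat e) => <- <-.
rewrite !input_at; try lia.
rewrite !encodeE !(nth_skip (s1 := [:: n; m])) ?(nth_skip (s1 := flat (medges G)))
  ?(nth_skip (s1 := [:: l])) ?size_flat /=; try lia.
by rewrite !nth_cat !size_flat !ifT; [split; f_equal; lia|lia|lia].
Qed.

Lemma input_k : A 0 (3 + (m + m) + (l + l)) = k.
Proof.
rewrite input_at; last lia.
rewrite !encodeE !(nth_skip (s1 := [:: n; m])) ?(nth_skip (s1 := flat (medges G)))
  ?(nth_skip (s1 := [:: l])) ?(nth_skip (s1 := flat (marcs G))) ?size_flat /=; try lia.
by rewrite (_ : _ - _ = 0) //; lia.
Qed.

Lemma input_pair (e : 'I_k) :
  A 0 (4 + (m + m) + (l + l) + (e + e)) = (tnth (in_tuple (enum P)) e).1 /\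
  A 0 (4 + (m + m) + (l + l) + (e + e) + 1) = (tnth (in_tuple (enum P)) e).2.
Proof.
have le := ltn_ord e; case: (nth_flat e) => <- <-.
rewrite !input_at; try lia.
rewrite !encodeE !(nth_skip (s1 := [:: n; m])) ?(nth_skip (s1 := flat (medges G)))
  ?(nth_skip (s1 := [:: l])) ?(nth_skip (s1 := flat (marcs G)))
  ?(nth_skip (s1 := [:: k])) ?size_flat /=; try lia.
by split; f_equal; lia.
Qed.

End Input.

(** * Correctness of the program *)

Section Phases.
Variables (n : nat) (G : mixed_graph n) (P : {set 'I_n * 'I_n}).
Notation m := (size (medges G)).
Notation l := (size (marcs G)).
Notation k := (size (enum P)).
Notation T := (m + m + l).
Let pair (j : 'I_k) := tnth (in_tuple (enum P)) j.

Lemma header_ok s : loaded (encode G P) s.2 ->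
  let s' := sem c_header s in
  s'.2 = s.2 /\
  [/\ s'.1 v_n = n, s'.1 v_m = m, s'.1 v_l = l, s'.1 v_k = k &
   [/\ s'.1 v_arcs = T, s'.1 v_arcs1 = T.+1 & s'.1 v_pairs = 4 + (m + m) + (l + l)]].
Proof.
move=> ld; rewrite /= /upd /=; split=> //.
rewrite (input_n ld) (input_m ld) (input_l ld) addn1.
have -> : 4 + (m + m) + (l + l) - 1 = 3 + (m + m) + (l + l) by lia.
by rewrite (input_k ld).
Qed.

Lemma edges_ok s : s.1 v_m = m ->
  let s' := sem c_edges s in forall e, e < m ->
  [/\ s'.2 1 e = s.2 0 (2 + (e + e)), s'.2 2 e = s.2 0 (3 + (e + e)),
      s'.2 1 (m + e) = s.2 0 (3 + (e + e)) & s'.2 2 (m + e) = s.2 0 (2 + (e + e))].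
Proof.
move=> sm s'.
pose I j (s1 : state) := [/\ s1.1 v_m = m, s1.2 0 = s.2 0 & forall e, e < j ->
  [/\ s1.2 1 e = s.2 0 (2 + (e + e)), s1.2 2 e = s.2 0 (3 + (e + e)),
      s1.2 1 (m + e) = s.2 0 (3 + (e + e)) & s1.2 2 (m + e) = s.2 0 (2 + (e + e))]].
suff [_ _] : I m s' by [].
rewrite -{1}sm; apply: for_ind => [j s1 [h1 h2 h3] x|j s1 jm [h1 h2 h3]|]; [by split| |by split].
rewrite sm in jm; split=> // e; rewrite ltnS => ej.
rewrite /= /upd /= h1 h2 !eqn_add2l.
have -> : (e == m + j) = false by lia.
have -> : (m + e == j) = false by lia.
by case: (eqVneq e j) => [->|ne] //; apply: h3; lia.
Qed.

Lemma arcs_ok s : s.1 v_m = m -> s.1 v_l = l ->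
  let s' := sem c_arcs s in
  (forall e, e < l -> s'.2 1 (m + m + e) = s.2 0 (3 + (m + m) + (e + e)) /\
                      s'.2 2 (m + m + e) = s.2 0 (4 + (m + m) + (e + e))) /\
  (forall i, i < m + m -> s'.2 1 i = s.2 1 i /\ s'.2 2 i = s.2 2 i).
Proof.
move=> sm sl s'.
pose I j (s1 : state) := [/\ s1.1 v_m = m, s1.2 0 = s.2 0,
  forall e, e < j -> s1.2 1 (m + m + e) = s.2 0 (3 + (m + m) + (e + e)) /\
                      s1.2 2 (m + m + e) = s.2 0 (4 + (m + m) + (e + e)) &
  forall i, i < m + m -> s1.2 1 i = s.2 1 i /\ s1.2 2 i = s.2 2 i].
suff [_ _] : I l s' by [].
rewrite -{1}sl; apply: for_ind => [j s1 [h1 h2 h3 h4] x|j s1 jm [h1 h2 h3 h4]|]; [by split| |by split].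
split=> // [e|i im]; rewrite /= /upd /= h1.
  rewrite ltnS h2 !eqn_add2l => ej; case: (eqVneq e j) => [->|ne]; last by apply: h3; lia.
  by split; congr (_ _); lia.
have -> : (i == m + m + j) = false by lia.
exact: h4.
Qed.

Lemma pow_ok s : s.1 v_n = n -> s.1 v_k = k ->
  let s' := sem c_pow s in
  [/\ s'.1 v_nn = n * n, s'.1 v_codes = n ^ k & forall i, i <= k -> s'.2 5 i = n ^ i].
Proof.
move=> sn sk s'.
set s0 := sem (Assign v_codes (Cst 1)) (sem (Assign v_nn (Sum 24 v_n (Var v_n))) s).
set L := For v_i v_k (Seq (Store 5 (Var v_i) (Var v_codes)) (Assign v_codes (Sum 24 v_n (Var v_codes)))).
have es : s' = sem (Store 5 (Var v_k) (Var v_codes)) (sem L s0) by [].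
pose I j (s1 : state) := [/\ s1.1 v_n = n, s1.1 v_codes = n ^ j & forall i, i < j -> s1.2 5 i = n ^ i].
have IL : I k (sem L s0).
  have -> : k = s0.1 v_k by rewrite -sk.
  apply: for_ind => [j s1 [h1 h2 h3] x|j s1 jk [h1 h2 h3]|]; [by split| |by split].
  split=> //=.
    by rewrite /upd /= sum_nat_const_nat subn0 h1 h2 expnS.
  by move=> i; rewrite ltnS /upd /= h2 => ij; case: (eqVneq i j) => [->|ne] //; apply: h3; lia.
have vk : (sem L s0).1 v_k = k by rewrite sem_v // -sk.
have vn2 : (sem L s0).1 v_nn = n * n.
  by rewrite sem_v // /s0 /= /upd /= sum_nat_const_nat subn0 sn.
move: (sem L s0) es IL vk vn2 => s2 es [h1 h2 h3] vk vn2.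
rewrite es /=; split=> // i ik; rewrite vk h2 /upd.
by case: (eqVneq i k) => [->|ne] //; apply: h3; rewrite ltn_neqAle ne.
Qed.

(** Arrays 3 and 4 must be zero because saturation never clears a mark. *)
Definition ready (s : state) :=
  [/\ env G P s.1, arc_tables G (s.2 1) (s.2 2), forall i, i <= k -> s.2 5 i = n ^ i,
      forall j : 'I_k, s.2 0 (4 + (m + m) + (l + l) + (j + j)) = (pair j).1 /\
                       s.2 0 (4 + (m + m) + (l + l) + (j + j) + 1) = (pair j).2 &
      forall i, s.2 3 i = 0 /\ s.2 4 i = 0].

Lemma tables_ok s : loaded (encode G P) s.2 -> ready (sem c_tables (sem c_header s)).
Proof.
move=> ld; have [sA [vn vm vl vk [vT vT1 vP]]] := header_ok ld.
set s0 := sem c_header s in sA vn vm vl vk vT vT1 vP *.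
have ld0 : loaded (encode G P) s0.2 by rewrite sA.
have es : sem c_tables s0 = sem c_pow (sem c_arcs (sem c_edges s0)) by exact: erefl.
have sv c : c \notin modv c_tables -> (sem c_tables s0).1 c = s0.1 c by exact: sem_v.
have sa a : a \notin moda c_tables -> (sem c_tables s0).2 a = s0.2 a by exact: sem_a.
move: (sem c_tables s0) es sv sa => s3.
set s1 := sem c_edges s0; set s2 := sem c_arcs s1 => es sv sa.
have [p1 p2 p3] : [/\ s3.1 v_nn = n * n, s3.1 v_codes = n ^ k & forall i, i <= k -> s3.2 5 i = n ^ i].
  by rewrite es; apply: pow_ok; rewrite /s2 sem_v // /s1 sem_v.
have [a1 a2] : (forall e, e < l -> s2.2 1 (m + m + e) = s0.2 0 (3 + (m + m) + (e + e)) /\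
                      s2.2 2 (m + m + e) = s0.2 0 (4 + (m + m) + (e + e))) /\
  (forall i, i < m + m -> s2.2 1 i = s1.2 1 i /\ s2.2 2 i = s1.2 2 i).
  have <- : s1.2 0 = s0.2 0 by rewrite /s1 sem_a.
  by apply: arcs_ok; rewrite /s1 sem_v.
have e1 := edges_ok vm; cbv zeta in e1; rewrite -/s1 in e1.
have A1 : s3.2 1 = s2.2 1 by rewrite es sem_a.
have A2 : s3.2 2 = s2.2 2 by rewrite es sem_a.
have A0 : s3.2 0 = s0.2 0 by rewrite sa.
clearbody s2 s1.
split=> //.
- split; [by rewrite sv|by rewrite sv|by rewrite sv|by rewrite sv|by split=> //; rewrite sv].
- rewrite A1 A2; split=> [[e b]|h].
    have [d1 d2] := input_edge ld0 e; have [h1 h2 h3 h4] := e1 _ (ltn_ord e).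
    have lte := ltn_ord e.
    have [|u1 u2] := a2 (arc_index (e, b)); first exact: arc_index_lt.
    rewrite {}u1 {}u2 /arc_index; case: b => /=; first by rewrite h1 h2 d1 d2.
    rewrite h3 h4 d1 d2 /dir /=; by [].
  have [-> ->] := a1 _ (ltn_ord h); exact: (input_arc ld0).
- by rewrite A0; apply: (input_pair ld0).
move=> i; rewrite !sa // sA; case: ld => _ h; by rewrite !h.
Qed.

Lemma n_gt0' (x : 'I_n) : 0 < n.
Proof. exact: leq_ltn_trans (leq0n _) (ltn_ord x). Qed.

(** * Filling the reachability table *)

Section Reach.
Variable s : state.
Hypothesis rd : ready s.
Notation src := (s.2 1). Notation dst := (s.2 2).

(** Rows are numbered [a * n + x] in the order of computation; the first [q] are finished and the
    rest is still blank. *)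
Definition reach_inv q (s' : state) :=
  [/\ forall c, c < 10 -> c != v_base -> s'.1 c = s.1 c, s'.1 v_base = q * n,
      forall a, a != 3 -> s'.2 a = s.2 a, forall i, q * n <= i -> s'.2 3 i = 0 &
      forall a (x y : 'I_n), a * n + x < q ->
        (s'.2 3 ((a * n + x) * n + y) != 0) = connect (arc_rel G src dst a) x y].

Lemma reach_row a (x : 'I_n) s' : a <= T -> reach_inv (a * n + x) s' ->
  s'.1 v_cut = a -> s'.1 v_x = x -> reach_inv (a * n + x).+1 (sem c_reach_row s').
Proof.
move=> aT [h1 h2 h3 h4 h5] va vx; set q := a * n + x in h2 h4 h5 *.
have [ev [tE tA] _ _ _] := rd.
have [en _ _ _ [eT _ _ _ _]] := ev.
set s1 := sem (Store 3 (Plus (Var v_base) (Var v_x)) (Cst 1)) s'.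
have v1 : s1.1 = s'.1 by [].
have A1 b : b != 3 -> s1.2 b = s.2 b by move=> b3; rewrite /s1 /= (negbTE b3) h3.
have A3 i : s1.2 3 i = if i == q * n + x then 1 else s'.2 3 i by rewrite /s1 /= /upd h2 vx.
have vn : s1.1 v_n = n by rewrite v1 h1.
(* Tails are nodes, so looking up the mark of a tail stays inside the current row. *)
have srcT h : h < T -> src h < n.
  move=> hT; case: (ltnP h m) => [hm|mh].
    by have [/= -> _] := tE (Ordinal hm, true).
  case: (ltnP h (m + m)) => [hm|mmh].
    have hm' : h - m < m by lia.
    by have [] := tE (Ordinal hm', false); rewrite /arc_index /= subnKC // => ->.
  have hl : h - (m + m) < l by lia.
  by have [] := tA (Ordinal hl); rewrite /= subnKC // => ->.
have er : sem c_reach_row s' = sem (Assign v_base (Plus (Var v_base) (Var v_n)))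
  (sem (saturate v_round v_y v_n 3 (Var v_base) ereachable) s1) by exact: erefl.
clearbody s1.
have [||[k1 k2 k3] mk] := @saturate_ok v_round v_y v_n 3 (Var v_base) ereachable s1 n (q * n)
   (arc_rel G src dst a) vn isT isT.
- by move=> s2 [j1 _ _]; rewrite /= j1 // v1.
- move=> s2 z [j1 j2 j3] vz.
  have vT : s2.1 v_arcs = T by rewrite j1 // v1 h1.
  rewrite (exists_Sum (N := T)
    (Q := fun h => (dst h == z) && ((h != a :> nat) && (s2.2 3 (q * n + src h) != 0))) vT).
    apply/existsP/existsP => [[h /and3P[/eqP hz ha hm]]|[y /andP[my /existsP[h /and3P[hz ha /eqP hy]]]]].
      exists (Ordinal (srcT h (ltn_ord h))); rewrite /mark hm /=.
      by apply/existsP; exists h; rewrite hz ha !eqxx.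
    by exists h; rewrite hz ha hy.
  have e2 : s2.2 2 = dst by rewrite j2 // A1.
  have e1 : s2.2 1 = src by rewrite j2 // A1.
  have ea : s2.1 v_cut = a by rewrite j1 // v1.
  have eB : s2.1 v_base = q * n by rewrite j1 // v1.
  by move=> h; rewrite !eval_bool /= /upd /= vz e2 e1 ea eB.
have ms z : mark 3 (q * n) s1 z = (z == x).
  rewrite /mark A3 eqn_add2l h4 ?leq_addr //.
  by have -> : (z == x :> nat) = (z == x) by []; case: (z == x).
have mk' z : mark 3 (q * n) (sem (saturate v_round v_y v_n 3 (Var v_base) ereachable) s1) z =
             connect (arc_rel G src dst a) x z.
  rewrite mk; apply/existsP/idP => [[y]|xz]; first by rewrite ms => /andP[/eqP->].
  by exists x; rewrite ms eqxx.
rewrite er.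
move: (sem (saturate v_round v_y v_n 3 (Var v_base) ereachable) s1) k1 k2 k3 mk' {mk er} => s2 k1 k2 k3 mk.
have xn := ltn_ord x.
split.
- move=> c c10 cB; rewrite /= /upd (negbTE cB) k1 ?v1 ?h1 //.
    by apply: contraTneq c10 => ->.
  by apply: contraTneq c10 => ->.
- by rewrite /= /upd /= !k1 // v1 h2 h1 // en mulSnr.
- by move=> b b3; rewrite /= k2 // A1.
- move=> i; rewrite mulSnr => iq; rewrite /= k3; last by lia.
  by rewrite A3 h4; last lia; case: eqP => // e; lia.
move=> a' x' y'; rewrite ltnS leq_eqVlt => /orP[/eqP e|lt].
  (* The row number determines [a'] and [x'] by division by [n] with remainder. *)
  have x'n := ltn_ord x'.
  have ex : x' = x.
    apply: val_inj; rewrite /= -[LHS](modn_small x'n) -[RHS](modn_small xn).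
    by rewrite -(modnMDl a' x' n) e modnMDl.
  have ea : a' = a.
    apply/eqP; rewrite -(eqn_pmul2r (n_gt0' x)); apply/eqP.
    by move: e; rewrite /q ex => /addIn.
  by rewrite e ea ex; apply: mk.
have y'n := ltn_ord y'.
have lt2 : (a' * n + x') * n + y' < q * n.
  by apply: leq_trans (_ : (a' * n + x').+1 * n <= _); rewrite ?leq_mul2r ?lt ?orbT // mulSnr ltn_add2l.
rewrite /= k3; last by lia.
rewrite A3; have -> : ((a' * n + x') * n + y' == q * n + x) = false by lia.
exact: h5.
Qed.

Lemma reach_inv_setv q i x s' : 9 < i -> reach_inv q s' -> reach_inv q (setv i x s').
Proof.
move=> i9 [h1 h2 h3 h4 h5]; split=> // [c c10 cB|]; rewrite /= /upd.
  by case: eqP => [e|_]; [lia|apply: h1].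
by case: eqP => [e|_]; [lia|apply: h2].
Qed.

Lemma reach_ok : let s' := sem c_reach s in
  [/\ forall c, c < 10 -> c != v_base -> s'.1 c = s.1 c,
      forall a, a != 3 -> s'.2 a = s.2 a &
      forall a (x y : 'I_n), a < m + m \/ a = T ->
        (s'.2 3 ((a * n + x) * n + y) != 0) = rch (keep G a) x y].
Proof.
have [ev tab _ _ z3] := rd; have [en _ _ _ [_ eT1 _ _ _]] := ev.
suff [h1 h2 h3 h4 h5] : reach_inv (T.+1 * n) (sem c_reach s).
  split=> // a x y aT; rewrite h5.
    by apply: eq_connect => u w; apply: arc_relE.
  have xn := ltn_ord x; have aT' : a <= T by case: aT; lia.
  by apply: leq_trans (_ : a.+1 * n <= _); rewrite ?leq_mul2r ?ltnS ?aT' ?orbT // mulSnr ltn_add2l.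
rewrite -[sem c_reach s]/(sem (For v_cut v_arcs1 (For v_x v_n c_reach_row)) (sem (Assign v_base (Cst 0)) s)).
set s0 := sem (Assign v_base (Cst 0)) s.
have -> : T.+1 = s0.1 v_arcs1 by rewrite /s0 /= /upd /= eT1.
have sn : s0.1 v_arcs1 = T.+1 by rewrite /s0 /= /upd /= eT1.
apply: (for_ind (I := fun j st => reach_inv (j * n) st)) => [j s1 h x|j s1 jT h|].
- exact: reach_inv_setv.
- rewrite sn in jT; set s2 := setv v_cut j s1.
  have h2 : reach_inv (j * n) s2 by apply: reach_inv_setv.
  have vn : s2.1 v_n = n by case: h2 => h2 _ _ _ _; rewrite h2.
  have va : s2.1 v_cut = j by rewrite /s2 /= /upd eqxx.
  suff [_] : (sem (For v_x v_n c_reach_row) s2).1 v_cut = j /\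
     reach_inv (j * n + s2.1 v_n) (sem (For v_x v_n c_reach_row) s2).
    by rewrite vn mulSnr.
  apply: (for_ind (I := fun i st => st.1 v_cut = j /\ reach_inv (j * n + i) st)).
  + by move=> i st [e1 e2] x; split=> //; apply: reach_inv_setv.
  + move=> i st; rewrite vn => i_n [e1 e2]; split; first by rewrite sem_v.
    rewrite addnS; apply: (reach_row (x := Ordinal i_n)) => //.
    exact: reach_inv_setv.
  + by rewrite addn0.
split=> // [c c10 cB|i _]; first by rewrite /s0 /= /upd (negbTE cB).
by case: (z3 i).
Qed.

End Reach.

(** * Game positions as numbers in base n *)

Lemma digits_exist q (g : nat -> nat) : (forall j, j < q -> g j < n) ->
  exists2 x, x < n ^ q & forall j, j < q -> x %/ n ^ j %% n = g j.
Proof.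
elim: q g => [|q IH] g gn; first by exists 0.
have [|x xq xg] := IH (fun j => g j.+1); first by move=> j jq; apply: gn.
have g0 := gn 0 isT; have n0 : 0 < n by apply: leq_ltn_trans g0.
exists (x * n + g 0).
  rewrite expnSr; apply: leq_trans (_ : x.+1 * n <= _); last by rewrite leq_mul2r xq orbT.
  by rewrite mulSnr ltn_add2l.
case=> [|j] jq; first by rewrite divn1 modnMDl modn_small.
by rewrite expnS divnMA divnMDl // (divn_small g0) addn0 xg.
Qed.

Lemma digit_surj (f : 'I_k -> 'I_n) : exists x : 'I_(n ^ k), (fun j => digit x j) =1 f.
Proof.
pose g j := if insub j is Some j' then nat_of_ord (f j') else 0.
have [|x xk xg] := @digits_exist k g.
  by move=> j jk; rewrite /g insubT /=.
exists (Ordinal xk) => j; apply: val_inj => /=.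
by rewrite xg // /g valK.
Qed.

(** Written in the shape of the final test of the program: a position that is marked by the
    saturation and has all tokens at their targets. *)
Lemma orientable_game : P_orientable G P =
  [exists x : 'I_(n ^ k), [exists x0 : 'I_(n ^ k), [forall j : 'I_k, digit x0 j == srcs j] &&
     connect (gstep G (fun x : 'I_(n ^ k) => digit (P := P) x) (@tgt n P)) x0 x] &&
     [forall j : 'I_k, digit x j == tgt j]].
Proof.
have main := @orientable_connect n G k 'I_(n ^ k) (fun x => digit (P := P) x) digit_surj
  (@srcs n P) (@tgt n P).
case: main => main1 main2; apply/idP/existsP.
  move=> /P_orientableE[o ho].
  have [|x0 [x [h0 h1 c]]] := main1.
    by exists o => j; apply: ho; rewrite -mem_enum; apply: mem_tnth.
  exists x; apply/andP; split; last by apply/forallP=> j; rewrite h1.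
  by apply/existsP; exists x0; rewrite c andbT; apply/forallP=> j; rewrite h0.
case=> x /andP[/existsP[x0 /andP[/forallP h0 c]] /forallP h1].
have [|o ho] := main2.
  by exists x0, x; split=> // j; apply/eqP.
apply/P_orientableE; exists o => p; rewrite -mem_enum => /(tnthP (in_tuple (enum P)))[j ->].
exact: ho.
Qed.

(** * Correctness of the search for the target position *)

Section Game.
Variable s : state.
Hypothesis rd : ready s.

(** What the game expressions assume of the arrays; array 4 is exempt, so writing marks there
    preserves it. *)
Definition tabs (A : nat -> nat -> nat) :=
  [/\ arc_tables G (A 1) (A 2), forall i, i <= k -> A 5 i = n ^ i,
      forall j : 'I_k, A 0 (4 + (m + m) + (l + l) + (j + j)) = (pair j).1 /\
                       A 0 (4 + (m + m) + (l + l) + (j + j) + 1) = (pair j).2 &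
      forall a (x y : 'I_n), a < m + m \/ a = T ->
        (A 3 ((a * n + x) * n + y) != 0) = rch (keep G a) x y].

Lemma tabs_ext A A' : (forall a, a != 4 -> A' a = A a) -> tabs A -> tabs A'.
Proof. by move=> h [h1 h2 h3 h4]; split; rewrite !h. Qed.

Lemma eall_ok v A c f (F : 'I_k -> 'I_n) : env G P v -> tabs A -> c < 24 \/ 30 < c ->
  v c < n ^ k ->
  (forall v' j, env G P v' -> v' 30 = nat_of_ord j -> eval v' A (f (Var 30)) = F j) ->
  (eval v A (eall (Var c) f) != 0) = [forall j : 'I_k, digit (v c) j == F j].
Proof.
move=> ev [t1 t2 t3 t4] hc vc hf; have [_ _ _ ek _] := ev.
apply: forall_All => // j; rewrite eval_Eq0.
have ev' : env G P (upd v 30 j) by apply: env_upd.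
have uc : upd v 30 j c = v c by rewrite /upd; case: eqP => // e; lia.
rewrite (edig_ok (j := j) t2 ev') ?uc //; last by rewrite !inE; lia.
by rewrite (hf _ j).
Qed.

Lemma game_ok : (sem c_search s).1 v_out = P_orientable G P.
Proof.
have [ev0 tab12 t5 pin z] := rd.
rewrite -[sem c_search s]/(sem c_game (sem c_reach s)).
have [v1 A1 t3] := reach_ok rd.
move: (sem c_reach s) v1 A1 t3 => s1 v1 A1 t3.
have ev1 : env G P s1.1 by apply: env_ext ev0.
have tb1 : tabs s1.2.
  split; [by rewrite !A1|by move=> i; rewrite A1 //; apply: t5|by rewrite !A1|exact: t3].
have [_ _ _ _ [_ _ _ eN1 _]] := ev1.
set L := For v_x v_codes (Store 4 (Var v_x) (eall (Var v_x) esrc)).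
set S := saturate v_round v_y v_codes 4 (Cst 0) (Sum 35 v_codes (And (Get 4 (Var 35)) (estep (Var 35) (Var v_y)))).
set R := Assign v_out (Not (Not (Sum 35 v_codes (And (Get 4 (Var 35)) (eall (Var 35) etgt))))).
rewrite -[sem c_game s1]/(sem R (sem S (sem L s1))).
pose I i (st : state) := [/\ forall c, c < 10 -> st.1 c = s1.1 c,
   forall a, a != 4 -> st.2 a = s1.2 a &
   forall x, x < i -> x < n ^ k ->
     (st.2 4 x != 0) = [forall j : 'I_k, digit x j == srcs j]].
have [v2 A2 m2] : I (n ^ k) (sem L s1).
  rewrite -eN1; apply: for_ind => [i st [h1 h2 h3] x|i st iN [h1 h2 h3]|]; last by [].
    by split=> // c c10; rewrite /= /upd; case: eqP => [e|_]; [lia|apply: h1].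
  rewrite eN1 in iN; set st1 := setv v_x i st.
  have vi : st1.1 v_x = i by rewrite /st1 /= /upd eqxx.
  have w1 c : c < 10 -> st1.1 c = s1.1 c.
    by move=> c10; rewrite /st1 /= /upd; case: eqP => [e|_]; [lia|apply: h1].
  have ev : env G P st1.1 by apply: env_ext ev1 => c c10 _; apply: w1.
  have tb : tabs st1.2 by apply: tabs_ext tb1.
  have e4 : st1.2 4 = st.2 4 by [].
  have eA a : a != 4 -> st1.2 a = s1.2 a by exact: h2.
  clearbody st1; split=> //.
    by move=> a a4; rewrite /= (negbTE a4) eA.
  move=> x; rewrite ltnS => xi xN.
  have -> : (sem (Store 4 (Var v_x) (eall (Var v_x) esrc)) st1).2 4 x =
      if x == st1.1 v_x then eval st1.1 st1.2 (eall (Var v_x) esrc) else st1.2 4 x by exact: erefl.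
  rewrite vi; case: (eqVneq x i) => [->|nx]; last by rewrite e4 h3 //; lia.
  rewrite (eall_ok (F := @srcs n P)) ?vi //; first by left.
  by move=> v' j ev' vj; case: tb => _ _ h _; apply: esrc_ok.
move: (sem L s1) v2 A2 m2 => s2 v2 A2 m2.
have ev2 : env G P s2.1 by apply: env_ext ev1 => c c10 _; apply: v2.
have tb2 : tabs s2.2 by apply: tabs_ext tb1.
have eN2 : s2.1 v_codes = n ^ k by rewrite v2.
have [//||[k1 k2 k3] mk] := @saturate_ok v_round v_y v_codes 4 (Cst 0)
  (Sum 35 v_codes (And (Get 4 (Var 35)) (estep (Var 35) (Var v_y)))) s2 (n ^ k) 0
  (gstep G (fun x : 'I_(n ^ k) => digit (P := P) x) (@tgt n P)) eN2 isT isT.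
  move=> s3 z0 [h1 h2 h3] vz.
  have eN : s3.1 v_codes = n ^ k by rewrite h1.
  apply: exists_Sum eN _ => x; rewrite eval_And0; congr (_ && _).
  have [t1 t2 t3' t4] : tabs s3.2 by apply: tabs_ext tb2.
  apply: estep_ok => //; apply: env_upd => //.
  by apply: env_ext ev2 => c c10 _; apply: h1; apply: contraTneq c10 => ->.
rewrite -/S in k1 k2 k3 mk.
move: (sem S s2) k1 k2 k3 mk => s3 k1 k2 k3 mk.
have ev3 : env G P s3.1.
  by apply: env_ext ev2 => c c10 _; apply: k1; apply: contraTneq c10 => ->.
have tb3 : tabs s3.2 by apply: tabs_ext tb2.
have [_ _ _ _ [_ _ _ eN3 _]] := ev3.
have -> : (sem R s3).1 v_out = eval s3.1 s3.2
  (Not (Not (Sum 35 v_codes (And (Get 4 (Var 35)) (eall (Var 35) etgt))))) by exact: erefl.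
rewrite !eval_Not eqb0 orientable_game; congr (nat_of_bool _).
apply: exists_Sum eN3 _ => x; rewrite eval_And0; congr (_ && _).
  have -> : eval (upd s3.1 35 x) s3.2 (Get 4 (Var 35)) = s3.2 4 (0 + x) by exact: erefl.
  rewrite [LHS]mk; apply: eq_existsb => x0; congr (_ && _).
  by rewrite /mark add0n m2.
rewrite (eall_ok (F := @tgt n P)) //.
- by right.
- exact: (ltn_ord x).
by move=> v' j ev' vj; case: tb3 => _ _ h _; apply: etgt_ok.
Qed.
End Game.
End Phases.

(** * Running time *)

Section Build.
Variables (c1 c2 c3 : cmd) (out : nat).

Definition code1 := ccmd (size prologue) c1.
Definition code2 := ccmd (size prologue + size code1) c2.
Definition code3 := ccmd (size prologue + size code1 + size code2) c3.
(** The last two instructions bring the output to cell 0, and running past the end of the code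
    halts. *)
Definition build :=
  prologue ++ code1 ++ code2 ++ code3 ++ [:: IConst 0 0; IAdd 0 (vr out) 0].

Definition bounded B c (s : state) := forall b, b \in bndc c -> s.1 b <= B /\ b \notin modv c.

Lemma build_ok L B : 3 < size L -> wfc 256 24 c1 -> wfc 256 24 c2 -> wfc 256 24 c3 -> out < 24 ->
  (forall s, loaded L s.2 -> [/\ bounded B c1 s, bounded B c2 (sem c1 s) &
                                bounded B c3 (sem c2 (sem c1 s))]) ->
  exists t s, [/\ t <= 1000 * size L + cc B c1 + cc B c2 + cc B c3 + 2, loaded L s.2 &
    exec build t (init_state L) = Some ((sem c3 (sem c2 (sem c1 s))).1 out)].
Proof.
move=> L4 w1 w2 w3 o24 hb.
have [ca0 /code_at_cat[ca1 /code_at_cat[ca2 /code_at_cat[ca3 ca4]]]] :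
    code_at build 0 prologue /\ code_at build (0 + size prologue)
     (code1 ++ code2 ++ code3 ++ [:: IConst 0 0; IAdd 0 (vr out) 0]) by exact: code_at_cat.
rewrite add0n in ca1 ca2 ca3 ca4.
have [t0 [m0 [A [l0 r0 am ld]]]] := prologue_ok L4 erefl ca0.
pose s : state := (fun r => m0 (vr r), A).
have lB : 256 <= 64 * size L by rewrite (leq_pmul2l (m := 64) (n1 := 4)).
have pl : vr 24 < 256 by [].
have sm0 : sim (64 * size L) 24 m0 s by split.
have [b1 b2 b3] := hb s ld.
have [t1 [m1 [l1 r1 sm1]]] := ccmd_ok lB pl ca1 w1 sm0 b1.
have [t2 [m2 [l2 r2 sm2]]] := ccmd_ok lB pl ca2 w2 sm1 b2.
have [t3 [m3 [l3 r3 sm3]]] := ccmd_ok lB pl ca3 w3 sm2 b3.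
have r4 := runs_straight m3 ca4 isT.
have r := runs_trans (runs_trans (runs_trans (runs_trans r0 r1) r2) r3) r4.
exists (t0 + t1 + t2 + t3 + 2), s; split=> //.
  by rewrite leq_add2r !leq_add.
rewrite /init_state (exec_runs r); last first.
  by rewrite nth_default // /build !size_cat !addnA.
by rewrite /effect /= /upd /= addn0; case: sm3 => _ ->.
Qed.

End Build.

(* There is a single RAM program and a constant c such that on every
   instance (G, P) (G mixed graph on n nodes with m edges+arcs) the program
   halts within (n + m + 2)^(c * (|P| + 1)) steps and outputs 1 if G is
   P-orientable and 0 otherwise. *)
Theorem theorem2 :
  exists (prog : seq instr) (c : nat),
    forall (n : nat) (G : mixed_graph n) (P : {set 'I_n * 'I_n}),
      exists t : nat,
        t <= (n + size (medges G) + size (marcs G) + 2) ^ (c * (#|P| + 1)) /\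
        exec prog t (init_state (encode G P)) = Some (nat_of_bool (P_orientable G P)).
Proof.
have [C1 [d1 h1]] := cc_poly c_header.
have [C2 [d2 h2]] := cc_poly c_tables.
have [C3 [d3 h3]] := cc_poly c_search.
(* [C] adds up the constants, 1000 for the prologue and 2 for delivering the output. [D] dominates
   every degree, and its summand 1 lets [X] bound the input length too. *)
pose C := 1000 + C1 + C2 + C3 + 2; pose D := 1 + d1 + d2 + d3.
exists (build c_header c_tables c_search v_out), (C + 3 * D) => n G P.
set b := n + _ + _ + 2; have b2 : 1 < b by rewrite /b; lia.
rewrite cardE; set k := size (enum P).
(* A common bound for the loop bounds: [b ^ k] covers [n ^ k] and [k], [b ^ 2] covers [n * n] and
   the linear ones. *)
pose B := b ^ (k + 2).
have bk : 0 < b ^ k by rewrite expn_gt0; lia.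
have kb : k < b ^ k by apply: ltn_expl.
have bB x : x <= b ^ k * (b * b) -> x <= B by rewrite /B expnD expnS expn1.
have le2 x : x <= 2 * b -> x <= B.
  move=> xb; apply: bB; apply: leq_trans xb _; apply: leq_trans (leq_pmull _ bk).
  by rewrite leq_mul2r b2 orbT.
have lek x : x <= b ^ k -> x <= B.
  by move=> xb; apply: bB; apply: leq_trans xb _; rewrite leq_pmulr // muln_gt0; lia.
have [] := @build_ok c_header c_tables c_search v_out (encode G P) B.
- by rewrite size_encode; lia.
- exact: wf_header.
- exact: wf_tables.
- exact: wf_search.
- by [].
- move=> s ld; have [_ [vn vm vl vk _]] := header_ok ld.
  have [[en em el ek [eT eT1 en2 eN _]] _ _ _ _] := tables_ok ld.
  split; first by [].
    move=> r /(allP bnd_tables)/andP[hr ->]; split=> //; move: hr; rewrite !inE.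
    case/or4P=> /eqP->; rewrite ?vn ?vm ?vl ?vk; try (by apply: le2; rewrite /b; lia).
    by apply: lek; apply: ltnW.
  move=> r /(allP bnd_search)/andP[hr ->]; split=> //; move: hr; rewrite !inE.
  case/orP=> [/eqP->|]; first by rewrite en; apply: le2; rewrite /b; lia.
  case/orP=> [/eqP->|]; first by rewrite em; apply: le2; rewrite /b; lia.
  case/orP=> [/eqP->|]; first by rewrite ek; apply: lek; apply: ltnW.
  case/orP=> [/eqP->|]; first by rewrite eT; apply: le2; rewrite /b; lia.
  case/orP=> [/eqP->|]; first by rewrite eT1; apply: le2; rewrite /b; lia.
  case/orP=> [/eqP->|/eqP->].
    rewrite en2; apply: bB; apply: leq_trans (leq_pmull _ bk).
    by apply: leq_mul; rewrite /b; lia.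
  rewrite eN; apply: lek; have nb : n <= b by rewrite /b; lia.
  by rewrite -/k; elim: (k) => // i IH; rewrite !expnS leq_mul.
move=> t [s [tle ld ex]]; exists t; split; last by rewrite ex (game_ok (tables_ok ld)).
have Bb : B.+1 <= b ^ (k + 3).
  rewrite /B (_ : k + 3 = (k + 2).+1); last by lia.
  by rewrite ltn_exp2l.
pose X := b ^ ((k + 3) * D).
have X0 : 0 < X by rewrite expn_gt0; lia.
have poly Ci di c : (forall B, cc B c <= Ci * B.+1 ^ di) -> di <= D -> cc B c <= Ci * X.
  move=> h dD; apply: leq_trans (h B) _; rewrite leq_mul2l; apply/orP; right.
  apply: leq_trans (_ : (b ^ (k + 3)) ^ di <= _).
    by case: di dD {h} => // di _; rewrite leq_exp2r.
  by rewrite -expnM leq_exp2l // leq_mul2l dD orbT.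
have szX : size (encode G P) <= X.
  rewrite size_encode -/k; apply: leq_trans (_ : 2 * B <= _).
    have := le2 (4 + (size (medges G) + size (medges G)) + (size (marcs G) + size (marcs G))).
    have : k + k <= B.
      apply: bB; apply: leq_trans (_ : b ^ k * 2 <= _); first by lia.
      by rewrite leq_mul2l; apply/orP; right; apply: leq_trans b2 (leq_pmulr _ _); lia.
    by rewrite /b; lia.
  apply: leq_trans (_ : b ^ (k + 3) <= _).
    rewrite /B (_ : k + 3 = (k + 2).+1); last by lia.
    by rewrite expnS leq_mul2r b2 orbT.
  by rewrite leq_exp2l // leq_pmulr.
have tX : t <= C * X.
  apply: leq_trans tle _; rewrite !mulnDl !leq_add //.
  - by rewrite leq_mul2l szX orbT.
  - by apply: poly h1 _; rewrite /D; lia.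
  - by apply: poly h2 _; rewrite /D; lia.
  - by apply: poly h3 _; rewrite /D; lia.
  by rewrite leq_pmulr.
apply: leq_trans tX _; apply: leq_trans (_ : b ^ C * X <= _).
  by rewrite leq_mul2r; apply/orP; right; apply: ltnW; apply: ltn_expl.
(* What remains is [C + (k + 3) * D <= (C + 3 * D) * (k + 1)], which explains the exponent. *)
rewrite -expnD leq_exp2l //; move: (C) (D) (k) => x y z; nia.
Qed.
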